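(* Let $0<\alpha<1/4$ and let $f^*,g^*$ be the Mellin transforms of $f,g$, respectively, satisfying the conditions $e^{\pi|s|}f^*(s),\ e^{\pi|s|}g^*(s)\in L_1(\sigma_\alpha)$. Let $$(f*g)(x)=\frac1{(2\pi i)^2}\int_{\sigma_\alpha}\int_{\sigma_\alpha}\frac{\cot(\pi s)\cot(\pi w)}{\cot(\pi(s+w))}f^*(s)g^*(w)x^{-s-w}\,ds\,dw,\qquad x>0.$$ If $(f*g)(x)=0$ for all $x>0$, then either $f(x)=0$ on $\mathbb{R}_+$ or $g(x)=0$ on $\mathbb{R}_+$.
   Context: $\mathbb{R}_+=(0,\infty)$; $\sigma_\alpha=\{s\in\mathbb{C}:s=\alpha+i\tau,\ \tau\in\mathbb{R}\}$, with $L_p(\sigma_\alpha)$ taken with respect to $|ds|=d\tau$. Here $f,g\in L_2(\mathbb{R}_+;x^{2\alpha-1}dx)$, i.e. they are complex-valued with $\int_0^\infty|f(x)|^2x^{2\alpha-1}dx<\infty$ and similarly for $g$; the Mellin transform is $f^*(s)=\int_0^\infty f(t)t^{s-1}dt$, $s\in\sigma_\alpha$, convergent in mean square in $L_2(\sigma_\alpha)$. Functions in this space are identified when they agree almost everywhere, so vanishing on $\mathbb{R}_+$ is understood in that sense. *)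

(* Defs.v *)
From mathcomp Require Import all_boot all_order all_algebra.
From mathcomp Require Import all_classical all_reals all_analysis.
From mathcomp.real_closed Require Import complex.

Set Implicit Arguments.
Unset Strict Implicit.
Unset Printing Implicit Defensive.

Import Order.TTheory GRing.Theory Num.Theory.
Import numFieldNormedType.Exports.
Import ComplexField.Normc.

Local Open Scope classical_set_scope.
Local Open Scope ring_scope.
Local Open Scope complex_scope.

Section ComplexFunctions.
Context {R : realType}.
Implicit Types (z s w : R[i]) (x a : R).

Definition cexp z : R[i] :=
  (expR (complex.Re z))%:C * (cos (complex.Im z) +i* sin (complex.Im z)).

Definition ccos z : R[i] := (cexp ('i * z) + cexp (- ('i * z))) / 2.

Definition csin z : R[i] := (cexp ('i * z) - cexp (- ('i * z))) / (2 * 'i).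

Definition ccot z : R[i] := ccos z / csin z.

(* The principal power; it is only used for 0 < x. *)
Definition cpow x z : R[i] := cexp (z * (ln x)%:C).

End ComplexFunctions.

Section ComplexIntegration.
Context {R : realType}.
Local Notation mu := (@lebesgue_measure R).
Implicit Types (D : set R) (h : R -> R[i]) (H : R[i] -> R[i]).

Definition cmeasurable_fun D h : Prop :=
  measurable_fun D (fun t => complex.Re (h t)) /\
  measurable_fun D (fun t => complex.Im (h t)).

Definition cintegral D h : R[i] :=
  Rintegral mu D (fun t => complex.Re (h t)) +i*
  Rintegral mu D (fun t => complex.Im (h t)).

(* h belongs to L_p(D; u(x) dx) *)
Definition cLp D (p : nat) (u : R -> R) h : Prop :=
  cmeasurable_fun D h /\
  (\int[mu]_(x in D) (normc (h x) ^+ p * u x)%:E < +oo)%E.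

(* H restricted to the line Re s = a belongs to L_p with respect to |ds| *)
Definition line_Lp (a : R) (p : nat) H : Prop :=
  cLp setT p (cst 1) (fun t => H (a +i* t)).

(* The integral of H(s) ds along the upward line Re s = a, where ds = i dt. *)
Definition line_integral (a : R) H : R[i] :=
  'i * cintegral setT (fun t => H (a +i* t)).

End ComplexIntegration.

Section Mellin.
Context {R : realType}.
Local Notation mu := (@lebesgue_measure R).
Implicit Types (f : R -> R[i]) (F G : R[i] -> R[i]).

Definition mellin_L2 (a : R) f : Prop :=
  cLp `]0, +oo[ 2 (fun x => x `^ (2 * a - 1)) f.

Definition mellin_trunc f (X : R) (s : R[i]) : R[i] :=
  cintegral `[X^-1, X] (fun t => f t * cpow t (s - 1)).

(* F is a representative of the Mellin transform of f on the line Re s = a.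
   The transform is defined only up to null sets of the line; the values of F
   off the line are irrelevant. *)
Definition is_mellin (a : R) f F : Prop :=
  line_Lp a 2 F /\
  (\int[mu]_t
      ((normc (F (a +i* t)%C - mellin_trunc f X (a +i* t)%C) ^+ 2)%:E))%E
    @[X --> +oo] --> 0%E.

(* The convolution of f and g, expressed through their Mellin transforms F, G;
   the inner integral is over s and the outer one over w. *)
Definition mellin_cot_conv (a : R) F G (x : R) : R[i] :=
  ((2 * (pi : R)%:C * 'i) ^+ 2)^-1 *
  line_integral a (fun w => line_integral a (fun s =>
    ccot ((pi : R)%:C * s) * ccot ((pi : R)%:C * w) / ccot ((pi : R)%:C * (s + w))
    * F s * G w * cpow x (- s - w))).

End Mellin.

(* Main.v *)
(* On the line [Re s = alpha] put [phi = cot(pi s) f*(s)], [psi = cot(pi w) g*(w)] and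
   [m = cot(pi (s + w))].  As a function of [y = ln x], the convolution is, up to the factor
   [e^(-2 alpha y)], the Fourier transform of the measure [phi psi / m] of the plane pushed
   forward by [p : (s, w) |-> Im (s + w)].  If it vanishes, then so does the pushforward of
   that measure: averaging in [y] against [e^(-y)] produces Poisson kernels, hence arctangents,
   hence half-lines, and half-lines generate the Borel sets.  Multiplying by the bounded
   function [m(p) e^(-i y p)] cancels the factor [1 / m] and gives [phi^(y) psi^(y) = 0] for
   all [y].  The hypothesis on [e^(pi |s|) f*(s)] makes [phi^] and [psi^] real analytic, so one
   of them is identically zero, and [f*] or [g*] vanishes almost everywhere on the line.

   The Mellin transform is injective: if [f* = 0], the truncated transforms tend to [0] in
   [L_2], hence so do their integrals over [b - h, b + h].  These are integrals of
   [f(x) x^(alpha - 1) e^(i b ln x) 2 sin(h ln x) / ln x] over growing windows of [x]; the full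
   integrand is integrable, and the same uniqueness argument applies with [p = ln]. *)

Require Import Defs.
From mathcomp Require Import all_boot all_order all_algebra.
From mathcomp Require Import all_classical all_reals all_analysis.
From mathcomp Require Import measurable_realfun.
From mathcomp.real_closed Require Import complex.
From mathcomp Require Import ring lra.

Set Implicit Arguments.
Unset Strict Implicit.
Unset Printing Implicit Defensive.

Import Order.TTheory GRing.Theory Num.Theory.
Import numFieldNormedType.Exports.
Import ComplexField.Normc.

Local Open Scope classical_set_scope.
Local Open Scope ring_scope.
Local Open Scope complex_scope.

(** * Integrals depending on a parameter *)

(** The obstacle is that [1 / m] couples [s] and [w], so the transform of [phi psi / m] does not
    split into a product. Since [Re (s + w)] is fixed, [m] is a function of [p] alone; a vanishing
    measure, unlike a mere vanishing transform, can be multiplied by such a function. The range of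
    [alpha] enters here: [alpha] and [2 alpha] lie in (0, 1/2), where [sin (pi x)] and [cos (pi x)]
    are positive, so [cot] and its inverse are bounded on both lines.

    The weight [e^(pi |s|)] dominates [e^(2 |t|)], as [pi >= 2]. One unit of this rate absorbs the
    powers of [t] produced by differentiating [phi^]; the other dominates the Taylor series for
    steps of length at most 1.

    In the Mellin part, [f(x) x^(alpha - 1)] is square integrable against [x dx] but need not be
    integrable. The decay in [ln x] gained by averaging supplies what is missing, because
    [1 / (x (1 + ln^2 x))] has a finite integral.

    Complex densities are carried as pairs of real functions; multiplication by [-i], which sends
    [(k1, k2)] to [(k2, - k1)], reduces imaginary parts to real parts. *)

Section RintegralTools.
Context d {T : measurableType d} {R : realType} (mu : {measure set T -> \bar R}).
Implicit Types (f g k : T -> R).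

Local Notation intble f := (mu.-integrable setT (EFin \o f)).

Lemma integrable_measurable f : intble f -> measurable_fun setT f.
Proof. by move=> /measurable_int/measurable_EFinP. Qed.

Lemma integrable_le_norm f g : measurable_fun setT f -> intble g ->
  (forall x, `|f x| <= `|g x|) -> intble f.
Proof.
move=> mf ig fg; apply: (le_integrable _ _ _ ig) => //.
  exact/measurable_EFinP.
by move=> x _ /=; rewrite lee_fin.
Qed.

Lemma integrable_mul_bounded f g (M : R) : intble f -> measurable_fun setT g ->
  (forall x, `|g x| <= M) -> intble (fun x => f x * g x).
Proof.
move=> intf mg gM.
apply: (@integrable_le_norm _ (fun x => M * `|f x|)).
- exact: measurable_funM (integrable_measurable intf) mg.
- rewrite (_ : EFin \o _ = (fun x => M%:E * (`|f x|)%:E)%E)//.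
  by apply: integrableZl => //; exact: integrable_norm.
- move=> x; rewrite !normrM normr_id mulrC ler_wpM2r//.
  by rewrite (le_trans (gM x)) ?ler_norm.
Qed.

Lemma Rintegral_dominated_cvg (f_ : nat -> T -> R) f (G : T -> R) :
  (forall n, measurable_fun setT (f_ n)) ->
  (forall x, f_ n x @[n --> \oo] --> f x) ->
  intble G -> (forall n x, `|f_ n x| <= G x) ->
  \int[mu]_x f_ n x @[n --> \oo] --> \int[mu]_x f x.
Proof.
move=> mf_ cf iG fG.
have mf : measurable_fun setT f.
  by apply: (measurable_fun_cvg mf_) => x _; exact: cf.
have [||||intf _ cv] := @dominated_convergence _ _ _ mu setT measurableT
  (fun n => EFin \o f_ n) (EFin \o f) (EFin \o G) _ _ _ iG.
- by move=> n; exact/measurable_EFinP.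
- exact/measurable_EFinP.
- by apply: aeW => x _; apply: cvg_EFin; [exact: nearW|exact: cf].
- by apply: aeW => x n _ /=; rewrite lee_fin; exact: fG.
apply: fine_cvg; rewrite fineK; first exact: cv.
exact: integrable_fin_num.
Qed.

Lemma Rintegral_eq0_dominated (f_ : nat -> T -> R) f (G : T -> R) :
  (forall n, measurable_fun setT (f_ n)) ->
  (forall x, f_ n x @[n --> \oo] --> f x) ->
  intble G -> (forall n x, `|f_ n x| <= G x) ->
  (forall n, \int[mu]_x f_ n x = 0) -> \int[mu]_x f x = 0.
Proof.
move=> mf_ cf iG fG f0; have := Rintegral_dominated_cvg mf_ cf iG fG.
by under eq_fun do rewrite f0; move/(cvg_unique _ (cvg_cst _)) => <-.
Qed.

Lemma is_derive_Rintegral (f f' : R -> T -> R) (a e : R) (G : T -> R) : 0 < e ->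
  (forall y, intble (f y)) ->
  (forall (y : R) t, is_derive y 1 (f ^~ t) (f' y t)) ->
  intble G -> (forall y t, `|y - a| < e -> `|f' y t| <= G t) ->
  is_derive a 1 (fun y => \int[mu]_t f y t) (\int[mu]_t f' a t).
Proof.
move=> e0 intf df iG f'G.
have d1E y t : partial1of2 f y t = f' y t.
  by rewrite partial1of2E; apply: derive_val.
have aI : `]a - e, a + e[%classic a by rewrite /= in_itv/=; lra.
have G_ub x y : `]a - e, a + e[%classic x -> setT y ->
    `|partial1of2 f x y| <= G y.
  rewrite /= in_itv/= => xae _; rewrite d1E; apply: f'G.
  by rewrite ltr_distl; lra.
have G0 y : 0 <= G y by apply: le_trans (f'G a y _); rewrite // subrr normr0.
have intf' x : `]a - e, a + e[%classic x -> intble (f x) by move=> _; exact: intf.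
have df' x y : `]a - e, a + e[%classic x -> setT y -> derivable (f ^~ y) x 1.
  by move=> _ _; apply: ex_derive.
apply: DeriveDef.
  exact: (derivable_under_integral measurableT aI intf' df' G0 iG G_ub).
rewrite -derive1E.
rewrite (differentiation_under_integral measurableT aI intf' df' G0 iG G_ub).
by apply: eq_Rintegral => t _; exact: d1E.
Qed.

(** Replaces integration of a vanishing identity over [y]: with [f] a primitive of [f'] in [y],
    differentiation under the integral sign avoids an exchange of integrals. The dominating function
    may depend on the centre [a], because differentiability is a local matter. *)
Lemma Rintegral_cst_of_derive0 (f f' : R -> T -> R) (G : R -> T -> R) :
  (forall y, intble (f y)) ->
  (forall (y : R) t, is_derive y 1 (f ^~ t) (f' y t)) ->
  (forall a, intble (G a)) ->
  (forall a y t, `|y - a| < 1 -> `|f' y t| <= G a t) ->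
  (forall y, \int[mu]_t f' y t = 0) ->
  forall a b, \int[mu]_t f a t = \int[mu]_t f b t.
Proof.
move=> intf df iG f'G f'0 a b.
apply: (@is_derive_0_is_cst _ (fun y => \int[mu]_t f y t)) => c.
by rewrite -(f'0 c); apply: (@is_derive_Rintegral _ _ _ 1 (G c)) => // y t; exact: f'G.
Qed.

End RintegralTools.

(** * Uniqueness of Fourier transforms *)

Section FourierUniqueness.
Context d {T : measurableType d} {R : realType} (mu : {measure set T -> \bar R}).
Implicit Types (k p : T -> R).

Local Notation intble f := (mu.-integrable setT (EFin \o f)).

Lemma measurableT_comp_continuous (g : R -> R) p : continuous g ->
  measurable_fun setT p -> measurable_fun setT (fun x => g (p x)).
Proof. by move=> cg; apply: measurableT_comp; exact: continuous_measurable_fun. Qed.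

(* The pushforward of [k . mu] by [p] has a vanishing Fourier transform. *)
Definition fourier_null k p := forall y : R,
  \int[mu]_x (k x * cos (y * p x)) = 0 /\ \int[mu]_x (k x * sin (y * p x)) = 0.

Let den u : R := 1 + u ^+ 2.

Let den_gt0 u : 0 < den u. Proof. by rewrite /den ltr_pwDl// sqr_ge0. Qed.

Let den_ge1 u : 1 <= den u. Proof. by rewrite /den lerDl sqr_ge0. Qed.

(** The primitive in [y] of [e^(-y) cos (y u)] that tends to 0 at infinity. Its value at [y = 0] is
    minus the Poisson kernel [1 / (1 + u^2)]. *)
Let primitive y u : R := expR (- y) * (u * sin (y * u) - cos (y * u)) / den u.

Let is_derive_primitive (y u : R) :
  is_derive y 1 (primitive ^~ u) (expR (- y) * cos (y * u)).
Proof.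

apply: is_derive_eq; rewrite /GRing.scale/= /den; field.
by rewrite gt_eqF// -/(den u) den_gt0.
Qed.

Let primitive_bound (y u : R) : `|primitive y u| <= 2 * expR (- y).
Proof.
rewrite /primitive normrM normfV (gtr0_norm (den_gt0 u)) ler_pdivrMr//.
rewrite normrM gtr0_norm ?expR_gt0// [leRHS]mulrAC [leLHS]mulrC ler_wpM2r ?expR_ge0//.
rewrite (le_trans (ler_normB _ _))// normrM.
have := sin_max (y * u); have := cos_max (y * u).
have := normr_ge0 u; rewrite /den -(real_normK (num_real u)).
set a := `|u|; set b := `|sin _| => a0 c1 s1.
have : a * b <= a by rewrite ler_piMr.
have := sqr_ge0 (a - 1); nra.
Qed.

Let measurable_primitive (y : R) p : measurable_fun setT p ->
  measurable_fun setT (fun x => primitive y (p x)).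
Proof.
move=> mp; apply: measurableT_comp_continuous mp => u.
apply: cvgM; last first.
  apply: cvgV; first by rewrite gt_eqF.
  by apply: cvgD; [exact: cvg_cst|apply: (@exprn_continuous _ 2)].
apply: cvgM; first exact: cvg_cst.
have cyu : {for u, continuous (fun u => y * u)}.
  by apply: cvgM; [exact: cvg_cst|exact: cvg_id].
apply: cvgB.
  apply: cvgM; first exact: cvg_id.
  by apply: (continuous_comp cyu); exact: continuous_sin.
by apply: (continuous_comp cyu); exact: continuous_cos.
Qed.

(** Reflecting and translating [p] only reflects the frequency and multiplies the transform by a
    phase, by the addition formulas. This centres the Poisson kernel at an arbitrary point [v]. *)
Let fourier_null_shift k p (v : R) : intble k -> measurable_fun setT p ->
  fourier_null k p -> fourier_null k (fun x => v - p x).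
Proof.
move=> intk mp k0 y; have [kc ks] := k0 y.
have mcos : measurable_fun setT (fun x => cos (y * p x)).
  apply: measurableT_comp_continuous; first exact: continuous_cos.
  by apply: measurable_funM => //; exact: measurable_cst.
have msin : measurable_fun setT (fun x => sin (y * p x)).
  apply: measurableT_comp_continuous; first exact: continuous_sin.
  by apply: measurable_funM => //; exact: measurable_cst.
have ikc : intble (fun x => k x * cos (y * p x)).
  by apply: (integrable_mul_bounded intk mcos (M := 1)) => x; exact: cos_max.
have iks : intble (fun x => k x * sin (y * p x)).
  by apply: (integrable_mul_bounded intk msin (M := 1)) => x; exact: sin_max.
have iZ c g : intble g -> intble (fun x => c * g x).
  by move=> ig; apply: (integrableZl _ _ ig).
split.
- transitivity (\int[mu]_x (cos (y * v) * (k x * cos (y * p x)) +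
                           sin (y * v) * (k x * sin (y * p x)))).
    by apply: eq_Rintegral => x _; rewrite mulrBr cosB; ring.
  by rewrite RintegralD ?RintegralZl ?kc ?ks ?mulr0 ?addr0//; exact: iZ.
- transitivity (\int[mu]_x (sin (y * v) * (k x * cos (y * p x)) -
                           cos (y * v) * (k x * sin (y * p x)))).
    by apply: eq_Rintegral => x _; rewrite mulrBr sinB; ring.
  by rewrite RintegralB ?RintegralZl ?kc ?ks ?mulr0 ?subr0//; exact: iZ.
Qed.

(** The integral of [k x * primitive y (p x)] has derivative 0 in [y] by hypothesis, hence is
    constant. It tends to 0 as [y] grows, and at [y = 0] it is minus the integral in question. *)
Let poisson0 k p : intble k -> measurable_fun setT p ->
  fourier_null k p -> \int[mu]_x (k x / (1 + p x ^+ 2)) = 0.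
Proof.
move=> intk mp k0.
have int_prim y : intble (fun x => k x * primitive y (p x)).
  apply: (integrable_mul_bounded intk (measurable_primitive y mp)) => x.
  exact: primitive_bound.
have cst_prim a b : \int[mu]_x (k x * primitive a (p x)) =
    \int[mu]_x (k x * primitive b (p x)).
  apply: (@Rintegral_cst_of_derive0 _ _ _ mu (fun y x => k x * primitive y (p x))
    (fun y x => k x * (expR (- y) * cos (y * p x)))
    (fun c x => expR (1 - c) * `|k x|)) => //.
  - move=> y x; have := is_derive_primitive y (p x) => dprim.
    by apply: is_derive_eq; rewrite /GRing.scale/=; ring.
  - by move=> c; apply: (integrableZl _ _ (integrable_norm intk)).
  (* The constant [e^(1 - c)] bounds [e^(-y)] on [|y - c| < 1]. *)
  - move=> c y x yc; rewrite !normrM mulrCA (mulrC `|k x|) mulrA ler_wpM2r//.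
    rewrite gtr0_norm ?expR_gt0//.
    rewrite (@le_trans _ _ (expR (- y)))//.
      by rewrite ler_piMr ?expR_ge0// cos_max.
    by rewrite ler_expR; move: yc; rewrite ltr_distl; lra.
  - move=> y; under eq_Rintegral do rewrite mulrCA.
    rewrite RintegralZl ?(k0 y).1 ?mulr0//.
    apply: (integrable_mul_bounded intk (M := 1)) => [|x]; last exact: cos_max.
    apply: measurableT_comp_continuous; first exact: continuous_cos.
    by apply: measurable_funM => //; exact: measurable_cst.
apply: (@Rintegral_eq0_dominated _ _ _ mu
  (fun n x => k x * primitive n%:R (p x) - k x * primitive 0 (p x)) _
  (fun x => 4 * `|k x|)).
- move=> n; apply: measurable_funB;
    by apply: measurable_funM (measurable_primitive _ mp);
       exact: integrable_measurable intk.
- move=> x.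
  have -> : k x / (1 + p x ^+ 2) = k x * 0 - k x * primitive 0 (p x).
    by rewrite /primitive mul0r sin0 cos0 oppr0 expR0 /den; ring.
  apply: cvgB; last exact: cvg_cst.
  apply: cvgM; first exact: cvg_cst.
  have e0 : 2 * expR (- n%:R) @[n --> \oo] --> (0 : R).
    rewrite -[X in _ --> X](mulr0 2); apply: cvgM; first exact: cvg_cst.
    exact: (cvg_comp _ _ cvgr_idn (@cvgr_expR R)).
  apply: (@squeeze_cvgr _ _ _ _ (fun n => - (2 * expR (- n%:R))) _ _ _ _ _ e0).
    apply: nearW => n; rewrite -ler_norml; exact: primitive_bound.
  by rewrite -[X in _ --> X]oppr0; exact: cvgN.
- by apply: (integrableZl _ _ (integrable_norm intk)).
- move=> n x; rewrite -mulrBr normrM mulrC ler_wpM2r//.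
  rewrite (le_trans (ler_normB _ _))//.
  have pb (y : R) : 0 <= y -> `|primitive y (p x)| <= 2.
    move=> y0; rewrite (le_trans (primitive_bound _ _))// ler_piMr//.
    by rewrite -expR0 ler_expR oppr_le0.
  by have := pb n%:R (ler0n _ _); have := pb 0 (lexx _); lra.
- by move=> n; rewrite RintegralB// (cst_prim n%:R 0) subrr.
Qed.

Let measurable_atan p (c e : R) : measurable_fun setT p ->
  measurable_fun setT (fun x => atan (c + e * p x)).
Proof.
move=> mp; apply: measurableT_comp_continuous; first exact: continuous_atan.
apply: measurable_funD; first exact: measurable_cst.
by apply: measurable_funM => //; exact: measurable_cst.
Qed.

Let atan_bound (u : R) : `|atan u| <= pi.
Proof.
have := atan_gtNpi2 u; have := atan_ltpi2 u; have := pi_gt0 R.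
by rewrite ler_norml; lra.
Qed.

Let cvg_atan_oo (u : R^nat) : u n @[n --> \oo] --> +oo ->
  atan (u n) @[n --> \oo] --> pi / 2.
Proof. by move=> uoo; exact: (cvg_comp _ _ uoo (@cvgy_atan R)). Qed.

(** The derivative in [v] is the integral against the Poisson kernel centred at [v], which is 0. The
    constant value is found by letting [v] tend to minus infinity: it is [- pi / 2] times the
    integral of [k], which is 0 as the transform at frequency 0. *)
Let atan0 k p (v : R) : intble k -> measurable_fun setT p ->
  fourier_null k p -> \int[mu]_x (k x * atan (v - p x)) = 0.
Proof.
move=> intk mp k0.
have matan c : measurable_fun setT (fun x => atan (c - p x)).
  by under eq_fun do rewrite -mulN1r; exact: measurable_atan.
have int_atan c : intble (fun x => k x * atan (c - p x)).
  by apply: (integrable_mul_bounded intk (matan c)) => x; exact: atan_bound.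
have cst_atan a b : \int[mu]_x (k x * atan (a - p x)) =
    \int[mu]_x (k x * atan (b - p x)).
  apply: (@Rintegral_cst_of_derive0 _ _ _ mu (fun y x => k x * atan (y - p x))
    (fun y x => k x / (1 + (y - p x) ^+ 2)) (fun=> fun x => `|k x|)) => //.
  - by move=> y x; apply: is_derive_eq; rewrite /GRing.scale/=; ring.
  - by move=> _; exact: integrable_norm.
  - move=> _ y x _; rewrite normrM ler_piMr// normfV.
    by rewrite gtr0_norm ?den_gt0// invf_le1 ?den_gt0// den_ge1.
  - move=> y; apply: poisson0 => //; last exact: fourier_null_shift.
    by apply: measurable_funB => //; exact: measurable_cst.
have intk0 : \int[mu]_x k x = 0.
  by have [+ _] := k0 0; under eq_Rintegral do rewrite mul0r cos0 mulr1.
have : \int[mu]_x (k x * (atan (v - p x) + pi / 2)) = 0.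
  apply: (@Rintegral_eq0_dominated _ _ _ mu
    (fun n x => k x * atan (v - p x) - k x * atan (- n%:R - p x)) _
    (fun x => (pi + pi) * `|k x|)).
  - move=> n; apply: measurable_funB;
      by apply: measurable_funM (matan _); exact: integrable_measurable intk.
  - move=> x; under eq_fun do rewrite -mulrBr.
    apply: cvgM; first exact: cvg_cst.
    apply: cvgD; first exact: cvg_cst.
    under eq_fun do rewrite -opprD atanN opprK.
    apply: cvg_atan_oo; apply/cvgryPge => A; near=> n.
    rewrite -lerBlDr; near: n; exact: nbhs_infty_ger.
  - by apply: (integrableZl _ _ (integrable_norm intk)).
  - move=> n x; rewrite -mulrBr normrM mulrC ler_wpM2r//.
    by rewrite (le_trans (ler_normB _ _))// lerD// atan_bound.
  - by move=> n; rewrite RintegralB// (cst_atan v (- n%:R)) subrr.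
under eq_Rintegral do rewrite mulrDr.
rewrite RintegralD//.
  by rewrite RintegralZr// intk0 mul0r addr0.
by apply: (integrable_mul_bounded intk (measurable_cst _) (M := pi / 2)) => x /=;
  rewrite ger0_norm// divr_ge0// pi_ge0.
Unshelve. all: by end_near. Qed.

(** Dilating [p] by [n^2] rescales frequencies and keeps the transform null. The functions
    [atan (n^2 (c - p) + n)] tend to [- pi / 2] where [c < p] and to [pi / 2] where [p <= c]; the
    extra summand [n] decides the boundary [p = c], so the limit is exactly an affine function of
    the indicator of the open half-line. *)
Lemma fourier_null_halfline k p (c : R) : intble k -> measurable_fun setT p ->
  fourier_null k p -> \int[mu]_x (k x * \1_[set z | c < p z] x) = 0.
Proof.
move=> intk mp k0.
have intk0 : \int[mu]_x k x = 0.
  by have [+ _] := k0 0; under eq_Rintegral do rewrite mul0r cos0 mulr1.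
have mI : measurable_fun setT (\1_[set z | c < p z] : T -> R).
  apply: measurable_indic; rewrite -[X in measurable X]setTI.
  rewrite (_ : [set z | _] = p @^-1` `]c, +oo[%classic); first exact: mp.
  by apply/seteqP; split => z /=; rewrite in_itv/= andbT.
have intI : intble (fun x => k x * \1_[set z | c < p z] x).
  apply: (integrable_mul_bounded intk mI (M := 1)) => x.
  by rewrite indicE; case: (_ \in _); rewrite ?normr1 ?normr0.
have : \int[mu]_x (k x * (pi / 2 - pi * \1_[set z | c < p z] x)) = 0.
  apply: (@Rintegral_eq0_dominated _ _ _ mu
    (fun n x => k x * atan (n%:R ^+ 2 * c + n%:R - n%:R ^+ 2 * p x)) _
    (fun x => pi * `|k x|)).
  - move=> n; apply: measurable_funM; first exact: integrable_measurable intk.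
    by under eq_fun do rewrite -mulNr; exact: measurable_atan.
  - move=> x; apply: cvgM; first exact: cvg_cst.
    rewrite indicE.
    have [cp|pc] := ltP c (p x).
      rewrite mem_set// mulr1 (_ : pi / 2 - pi = - (pi / 2)); last by lra.
      under eq_fun do rewrite -[atan _]opprK -atanN.
      apply: cvgN; apply: cvg_atan_oo; apply/cvgryPge => A; near=> n.
      have n1 : 1 <= n%:R :> R by near: n; exact: nbhs_infty_ger.
      (* This gives [n^2 (p x - c) - n >= n |A| >= A]. *)
      have ncp : (`|A| + 1) / (p x - c) <= n%:R by near: n; exact: nbhs_infty_ger.
      move: ncp; rewrite ler_pdivrMr ?subr_gt0// => ncp.
      have := ler_norm A; have := normr_ge0 A; nra.
    rewrite memNset ?mulr0 ?subr0; last by apply/negP; rewrite -leNgt.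
    apply: cvg_atan_oo; apply/cvgryPge => A; near=> n.
    have nA : A <= n%:R by near: n; exact: nbhs_infty_ger.
    have : 0 <= n%:R ^+ 2 * (c - p x) by rewrite mulr_ge0 ?sqr_ge0 ?subr_ge0.
    by nra.
  - by apply: (integrableZl _ _ (integrable_norm intk)).
  - by move=> n x; rewrite normrM mulrC ler_wpM2r// atan_bound.
  - move=> n; apply: (@atan0 k (fun x => n%:R ^+ 2 * p x)) => //.
      by apply: measurable_funM => //; exact: measurable_cst.
    by move=> y; under eq_fun do rewrite mulrA;
      under [X in _ /\ X = _]eq_Rintegral do rewrite mulrA; exact: k0.
under eq_Rintegral do rewrite mulrBr [X in _ - X]mulrCA.
have i2 : intble (fun x => k x * (pi / 2)).
  by apply: (integrable_mul_bounded intk (measurable_cst _) (M := pi / 2)) => x /=;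
    rewrite ger0_norm// divr_ge0// pi_ge0.
have i3 : intble (fun x => pi * (k x * \1_[set z | c < p z] x)).
  by apply: (integrableZl _ _ intI).
rewrite [LHS](RintegralB measurableT i2 i3).
rewrite RintegralZr// [in X in _ - X]RintegralZl// intk0 mul0r sub0r => /eqP.
by rewrite oppr_eq0 mulf_eq0 gt_eqF ?pi_gt0//= => /eqP.
Unshelve. all: by end_near. Qed.

End FourierUniqueness.

(** * From half-lines to Borel sets and to functions of [p] *)

Section FourierUniquenessBorel.
Import HBNNSimple.
Context d {T : measurableType d} {R : realType} (mu : {measure set T -> \bar R}).
Implicit Types (k p : T -> R).

Local Notation intble f := (mu.-integrable setT (EFin \o f)).

Lemma integral_indicM (A : set T) k :
  (\int[mu]_(x in A) (k x)%:E = \int[mu]_x (k x * \1_A x)%:E)%E.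
Proof.
rewrite integral_mkcond; apply: eq_integral => x _.
by rewrite patchE indicE; case: ifPn => _; rewrite ?mulr1 ?mulr0.
Qed.

Lemma measurable_preimage p (S : set R) : measurable_fun setT p ->
  measurable S -> measurable (p @^-1` S).
Proof. by move=> mp mS; rewrite -[X in measurable X]setTI; exact: mp. Qed.

(** Dynkin's argument: open half-lines are stable under intersection, complements are handled by the
    total integral being 0 (frequency 0), and countable disjoint unions by sigma-additivity of the
    integral of [k]. *)
Lemma fourier_null_preimage k p (S : set R) : intble k ->
  measurable_fun setT p -> fourier_null mu k p -> measurable S ->
  (\int[mu]_(x in p @^-1` S) (k x)%:E = 0)%E.
Proof.
move=> intk mp k0 mS.
have intS (A : set T) : measurable A -> mu.-integrable A (EFin \o k).
  by move=> mA; apply: integrableS intk.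
have int0 : (\int[mu]_x (k x)%:E = 0)%E.
  have [+ _] := k0 0; under eq_Rintegral do rewrite mul0r cos0 mulr1.
  rewrite /Rintegral => h; rewrite -[LHS]fineK ?h//.
  exact: integrable_fin_num intk.
pose P (S : set R) := (\int[mu]_(x in p @^-1` S) (k x)%:E = 0)%E.
have RE : @measurable _ (measurableTypeR R) = <<s @RGenOInfty.G R >>.
  exact: RGenOInfty.measurableE.
rewrite -/(P S).
have mS' : <<s @RGenOInfty.G R >> S by rewrite -RE.
move: mS'; apply: (@dynkin_induction _ (measurableTypeR R) _ P RE).
- move=> _ _ [x ->] [y ->]; exists (Num.max x y).
  by apply/seteqP; split => z /=; rewrite !in_itv/= !andbT gt_max => /andP.
- by rewrite /P preimage_setT.
- move=> _ [c ->]; rewrite /P integral_indicM -[LHS]fineK.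
    rewrite -[X in X%:E]/(Rintegral _ _ _); congr EFin.
    rewrite -(fourier_null_halfline c intk mp k0).
    apply: eq_Rintegral => x _; congr (_ * \1_ _ _).
    by apply/seteqP; split => z /=; rewrite in_itv/= andbT.
  rewrite -integral_indicM; apply: integrable_fin_num; last apply: intS;
  by apply: measurable_preimage => //; exact: measurable_itv.
- move=> A mA PA; rewrite /P preimage_setC.
  have mpA := measurable_preimage mp mA.
  have := int0; rewrite -(setUv (p @^-1` A)) integral_setU//.
  + by rewrite -/(P A) PA add0e.
  + exact: measurableC.
  + by rewrite setUv; apply: measurable_int intk.
  + by apply/disj_setPS; rewrite setICr.
- move=> F mF tF PF; rewrite /P preimage_bigcup integral_bigcup.
  + by apply: eseries0 => i _ _; exact: PF.
  + apply/trivIsetP => i j _ _ ij; rewrite -preimage_setI.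
    by move/trivIsetP : tF => ->//; rewrite preimage_set0.
  + by move=> n; exact: measurable_preimage mp (mF n).
  + by apply: intS; apply: bigcup_measurable => n _; exact: measurable_preimage mp (mF n).
Qed.

Let nnsfun0 k p (g : {nnsfun measurableTypeR R >-> R}) : intble k -> measurable_fun setT p ->
  fourier_null mu k p -> \int[mu]_x (k x * g (p x)) = 0.
Proof.
move=> intk mp k0; rewrite /Rintegral.
pose s := finmap.enum_fset (fset_set (range g)).
pose h (i : nat) x : R := k x * \1_(p @^-1` (g @^-1` [set s`_i])) x.
have mg (y : R) : measurable (g @^-1` [set y]).
  rewrite -[X in measurable X]setTI.
  by apply: (@measurable_funPT _ _ _ _ g) => //; exact: measurable_set1.
have mpg i : measurable (p @^-1` (g @^-1` [set s`_i])).
  by apply: measurable_preimage mp _; exact: mg.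
have inth i : mu.-integrable setT (fun x => (s`_i)%:E * (h i x)%:E)%E.
  apply: integrableZl => //; apply: (integrable_mul_bounded intk (M := 1)).
    exact: measurable_indic.
  by move=> x; rewrite indicE; case: (_ \in _); rewrite ?normr1 ?normr0.
under eq_integral do rewrite fimfunEord -/s mulr_sumr -sumEFin.
transitivity (fine (\int[mu]_x \sum_(i < size s) ((s`_i)%:E * (h i x)%:E))%E).
  by congr fine; apply: eq_integral => x _; apply: eq_bigr => i _;
     rewrite -EFinM /h mulrCA; congr (_ * (_ * _))%:E.
rewrite integral_sum// big1// => i _.
rewrite integralZl//; last first.
  apply: (integrable_mul_bounded intk (M := 1)).
    exact: measurable_indic.
  by move=> x; rewrite indicE; case: (_ \in _); rewrite ?normr1 ?normr0.
rewrite -integral_indicM fourier_null_preimage ?mule0//; exact: mg.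
Qed.

(** Approximation of [m] by simple functions from below, with [|k m(p)|] as the dominating function.
    It is [m] that is split into positive and negative parts, not [k]: the vanishing is known only
    for the signed density [k] as a whole. *)
Lemma fourier_null_comp k p (m : R -> R) : intble k -> measurable_fun setT p ->
  fourier_null mu k p -> measurable_fun setT m ->
  intble (fun x => k x * m (p x)) -> \int[mu]_x (k x * m (p x)) = 0.
Proof.
move=> intk mp k0.
have ge0_case (n : R -> R) : (forall u, 0 <= n u) -> measurable_fun setT n ->
    intble (fun x => k x * n (p x)) -> \int[mu]_x (k x * n (p x)) = 0.
  move=> n0 mn intkn.
  have mn' : measurable_fun [set: measurableTypeR R] (EFin \o n).
    exact/measurable_EFinP.
  pose g := nnsfun_approx measurableT mn'.
  apply: (@Rintegral_eq0_dominated _ _ _ mu (fun i x => k x * g i (p x)) _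
    (fun x => `|k x * n (p x)|)).
  - move=> i; apply: measurable_funM; first exact: integrable_measurable intk.
    exact: (measurableT_comp (@measurable_funPT _ _ _ _ (g i)) mp).
  - move=> x; apply: cvgM; first exact: cvg_cst.
    have n0' u : setT u -> (0 <= (EFin \o n) u)%E by rewrite lee_fin.
    by have /fine_cvgP[_] := cvg_nnsfun_approx measurableT mn' n0' (x := p x) I.
  - exact: integrable_norm.
  - move=> i x; rewrite !normrM ler_wpM2l// !ger0_norm//.
    rewrite -lee_fin /g nnsfun_approxE.
    by apply: (@le_approx _ _ _ setT (EFin \o n)) => // u _; rewrite lee_fin.
  - by move=> i; exact: nnsfun0.
move=> mm intkm.
have intpos : intble (fun x => k x * m^\+ (p x)).
  apply: integrable_le_norm intkm _ => [|x].
    apply: measurable_funM; first exact: integrable_measurable intk.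
    by apply: measurableT_comp => //; exact: measurable_funrpos.
  rewrite !normrM ler_wpM2l// (ger0_norm (funrpos_ge0 _ _)) /funrpos.
  by rewrite ge_max normr_ge0 ler_norm.
have intneg : intble (fun x => k x * m^\- (p x)).
  apply: integrable_le_norm intkm _ => [|x].
    apply: measurable_funM; first exact: integrable_measurable intk.
    by apply: measurableT_comp => //; exact: measurable_funrneg.
  rewrite !normrM ler_wpM2l// (ger0_norm (funrneg_ge0 _ _)) /funrneg.
  by rewrite ge_max normr_ge0 -normrN ler_norm.
transitivity (\int[mu]_x (k x * m^\+ (p x) - k x * m^\- (p x))).
  apply: eq_Rintegral => x _; rewrite -mulrBr; congr (_ * _).
  by rewrite -[in LHS](funrposBneg m).
rewrite (RintegralB measurableT intpos intneg) !ge0_case ?subrr//.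
- exact: measurable_funrneg.
- exact: measurable_funrpos.
Qed.

End FourierUniquenessBorel.

Section FourierUniquenessLine.
Context {R : realType}.
Local Notation mu := (@lebesgue_measure R).
Implicit Types (k p : R -> R).

Lemma ae_eq0_of_integral k : mu.-integrable setT (EFin \o k) ->
  (forall S : set R, measurable S -> (\int[mu]_(x in S) (k x)%:E = 0)%E) ->
  {ae mu, forall x, k x = 0}.
Proof.
move=> intk k0.
have : ae_eq mu setT (EFin \o k) (EFin \o cst 0).
  apply: integral_ae_eq => //; first exact/measurable_EFinP.
  move=> S _ mS; rewrite [LHS]k0//.
  by rewrite [RHS]integral0.
by apply: filterS => x /(_ I)[].
Qed.

Lemma fourier_null_id_ae k : mu.-integrable setT (EFin \o k) ->
  fourier_null mu k id -> {ae mu, forall x, k x = 0}.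
Proof.
move=> intk k0; apply: ae_eq0_of_integral => // S mS.
exact: (fourier_null_preimage intk (@measurable_id _ _ setT) k0 mS).
Qed.

Lemma fourier_null_ln_ae k : mu.-integrable setT (EFin \o k) ->
  (forall x, x <= 0 -> k x = 0) ->
  fourier_null mu k (@ln R) -> {ae mu, forall x, k x = 0}.
Proof.
move=> intk kneg k0; apply: ae_eq0_of_integral => // S mS.
have mS' : measurable (expR @^-1` S) by apply: measurable_preimage => //; exact: measurable_expR.
have := fourier_null_preimage intk (@measurable_ln R) k0 mS'.
rewrite integral_indicM => null; rewrite integral_indicM -{}null.
apply: eq_integral => x _; rewrite !indicE.
have [x0|x0] := leP x 0; first by rewrite kneg// !mul0r.
rewrite (_ : (x \in @ln R @^-1` (expR @^-1` S)) = (x \in S))//.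
by apply/idP/idP => /set_mem/=; rewrite ?lnK ?posrE// => h; apply/mem_set; rewrite /= ?lnK ?posrE.
Qed.

End FourierUniquenessLine.

(** * Fourier transforms of complex densities *)

Section FourierPair.
Context d {T : measurableType d} {R : realType} (mu : {measure set T -> \bar R}).
Implicit Types (k p : T -> R).

Local Notation intble f := (mu.-integrable setT (EFin \o f)).

(* Real and imaginary parts of the integral of [(k1 + i k2) e^(- i y p)]. *)
Definition fourier_re k1 k2 p (y : R) :=
  \int[mu]_x (k1 x * cos (y * p x) + k2 x * sin (y * p x)).

Definition fourier_im k1 k2 p (y : R) := fourier_re k2 (\- k1) p y.

Lemma integrable_mul_cos k p (y : R) : intble k -> measurable_fun setT p ->
  intble (fun x => k x * cos (y * p x)).
Proof.
move=> intk mp; apply: (integrable_mul_bounded intk (M := 1)) => [|x]; last exact: cos_max.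
apply: measurableT_comp_continuous; first exact: continuous_cos.
by apply: measurable_funM => //; exact: measurable_cst.
Qed.

Lemma integrable_mul_sin k p (y : R) : intble k -> measurable_fun setT p ->
  intble (fun x => k x * sin (y * p x)).
Proof.
move=> intk mp; apply: (integrable_mul_bounded intk (M := 1)) => [|x]; last exact: sin_max.
apply: measurableT_comp_continuous; first exact: continuous_sin.
by apply: measurable_funM => //; exact: measurable_cst.
Qed.

Lemma integrableN_EFin k : intble k -> intble (\- k).
Proof.
move=> intk; have := integrableN intk.
by apply: eq_integrable => // x _ /=; rewrite EFinN.
Qed.

Lemma fourier_reE k1 k2 p y : intble k1 -> intble k2 -> measurable_fun setT p ->
  fourier_re k1 k2 p y =
  \int[mu]_x (k1 x * cos (y * p x)) + \int[mu]_x (k2 x * sin (y * p x)).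
Proof.
move=> i1 i2 mp.
by rewrite [LHS](RintegralD measurableT (integrable_mul_cos y i1 mp) (integrable_mul_sin y i2 mp)).
Qed.

(* No integrability is needed: [fine] maps both infinities to [0]. *)
Lemma RintegralN k : \int[mu]_x (- k x) = - \int[mu]_x k x.
Proof.
rewrite /Rintegral; under eq_integral do rewrite EFinN.
rewrite [in LHS]integralE [in RHS]integralE.
under eq_integral do rewrite funeposN.
under [X in (_ - X)%E]eq_integral do rewrite funenegN.
rewrite addeC -fineN.
by case: (\int[mu]_x _)%E => [r| |]; case: (\int[mu]_x _)%E => [s| |]//=;
  rewrite ?oppr0// opprD opprK.
Qed.

Lemma fourier_imE k1 k2 p y : intble k1 -> intble k2 -> measurable_fun setT p ->
  fourier_im k1 k2 p y =
  \int[mu]_x (k2 x * cos (y * p x)) - \int[mu]_x (k1 x * sin (y * p x)).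
Proof.
move=> i1 i2 mp; rewrite [LHS]fourier_reE//; last exact: integrableN_EFin.
congr (_ + _); rewrite -RintegralN.
by apply: eq_Rintegral => x _; rewrite mulNr.
Qed.

(* The transform at [y] and at [- y] separates the even part of the kernel (cos)
   from its odd part (sin), hence also the real part of the density from its
   imaginary part. *)
Lemma fourier_null_pair k1 k2 p : intble k1 -> intble k2 -> measurable_fun setT p ->
  (forall y, fourier_re k1 k2 p y = 0 /\ fourier_im k1 k2 p y = 0) ->
  fourier_null mu k1 p /\ fourier_null mu k2 p.
Proof.
move=> i1 i2 mp k0.
have cosE k y : \int[mu]_x (k x * cos (- y * p x)) = \int[mu]_x (k x * cos (y * p x)).
  by apply: eq_Rintegral => x _; rewrite mulNr cosN.
have sinE k y :
    \int[mu]_x (k x * sin (- y * p x)) = - \int[mu]_x (k x * sin (y * p x)).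
  rewrite -RintegralN.
  by apply: eq_Rintegral => x _; rewrite mulNr sinN mulrN.
have H y : \int[mu]_x (k1 x * cos (y * p x)) = 0 /\ \int[mu]_x (k1 x * sin (y * p x)) = 0
    /\ \int[mu]_x (k2 x * cos (y * p x)) = 0 /\ \int[mu]_x (k2 x * sin (y * p x)) = 0.
  have [] := k0 y; have [] := k0 (- y).
  rewrite !fourier_reE// !fourier_imE// !cosE !sinE//.
  by move=> *; do !split; lra.
by split=> y; have [? [? [? ?]]] := H y.
Qed.

End FourierPair.

(** * Exponentially decaying densities and their moments *)

Section ExponentialDecay.
Context {R : realType}.
Local Notation mu := (@lebesgue_measure R).
Implicit Types (f g u : R -> R).

Local Notation intble f := (mu.-integrable setT (EFin \o (f : R -> R))).

Definition exp_decay (a : R) f :=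
  measurable_fun setT f /\ intble (fun s => f s * expR (a * `|s|)).

Let measurable_exp_abs (a : R) : measurable_fun setT (fun s : R => expR (a * `|s|)).
Proof.
apply: measurableT_comp; first exact: measurable_expR.
by apply: measurable_funM; [exact: measurable_cst|exact: (@normr_measurable R setT)].
Qed.

Lemma exp_decayW (a b : R) f g : a <= b -> measurable_fun setT g ->
  (forall s, `|g s| <= `|f s|) -> exp_decay b f -> exp_decay a g.
Proof.
move=> ab mg gf [mf intf]; split => //.
apply: integrable_le_norm intf _ => [|s].
  by apply: measurable_funM => //; exact: measurable_exp_abs.
rewrite !normrM ler_pM// (ger0_norm (expR_ge0 (a * _))).
by rewrite (ger0_norm (expR_ge0 (b * _))) ler_expR ler_wpM2r.
Qed.

Lemma exp_decay_int (a : R) f : 0 <= a -> exp_decay a f -> intble f.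
Proof.
move=> a0 [mf intf]; apply: integrable_le_norm intf _ => // s.
rewrite normrM ler_peMr// ger0_norm ?expR_ge0// -[leLHS]expR0 ler_expR.
exact: mulr_ge0.
Qed.

Lemma exp_decayD (a : R) f g : exp_decay a f -> exp_decay a g -> exp_decay a (f \+ g).
Proof.
move=> [mf intf] [mg intg]; split; first exact: measurable_funD.
have := integrableD measurableT intf intg.
by apply: eq_integrable => // s _ /=; rewrite -EFinD mulrDl.
Qed.

Lemma exp_decayM (a : R) f u (M : R) : exp_decay a f -> measurable_fun setT u ->
  (forall s, `|u s| <= M) -> exp_decay a (fun s => f s * u s).
Proof.
move=> [mf intf] mu' uM; split; first exact: measurable_funM.
have := integrable_mul_bounded intf mu' uM.
by apply: eq_integrable => // s _ /=; rewrite mulrAC.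
Qed.

Lemma exp_decayN (a : R) f : exp_decay a f -> exp_decay a (\- f).
Proof.
move=> df; apply: (exp_decayW _ _ _ df) => //; last by move=> s; rewrite normrN.
by apply: measurable_funN; case: df.
Qed.

(** One unit of the rate is spent on [|s|^n <= n! e^|s|]. *)
Lemma exp_decay_monomial (n : nat) f : exp_decay 2 f ->
  exp_decay 1 (fun s => s ^+ n * f s).
Proof.
move=> [mf intf]; have mX : measurable_fun setT (fun s : R => s ^+ n).
  exact: measurable_funX.
split; first exact: measurable_funM.
have intZ : intble (fun s => n`!%:R * (f s * expR (2 * `|s|))).
  exact: (integrableZl measurableT _ intf).
apply: integrable_le_norm intZ _ => [|s].
  by apply: measurable_funM; [exact: measurable_funM|exact: measurable_exp_abs].
have fact0 : 0 < n`!%:R :> R by rewrite ltr0n fact_gt0.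
have sn : `|s| ^+ n <= n`!%:R * expR `|s|.
  rewrite mulrC -ler_pdivrMr//; case: n fact0 {mX} => [|n] fact0.
    by rewrite expr0 divr1 -expR0 ler_expR.
  have := expR_ge1Dxn n (normr_ge0 s); lra.
rewrite !normrM normrX (ger0_norm (ltW fact0)) !(ger0_norm (expR_ge0 _)) mul1r.
rewrite (_ : 2 * `|s| = `|s| + `|s|) ?expRD; last by ring.
rewrite (_ : _ * (`|f s| * _) = n`!%:R * expR `|s| * `|f s| * expR `|s|); last by ring.
by rewrite !ler_wpM2r// expR_ge0.
Qed.

Let partial_exp_le (c : nat -> R) (y : R) (n : nat) : (forall i, `|c i| <= 1) ->
  `|\sum_(0 <= i < n) c i * y ^+ i / i`!%:R| <= expR `|y|.
Proof.
move=> c1; apply: (@le_trans _ _ (series (exp_coeff `|y|) n)).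
  rewrite (le_trans (ler_norm_sum _ _ _))// ler_sum// => i _.
  rewrite !normrM normrX normfV (ger0_norm (ler0n _ _)) /exp_coeff/=.
  by rewrite ler_wpM2r ?invr_ge0// ler_piMl// exprn_ge0.
rewrite /expR; apply: nondecreasing_cvgn_le; last exact: is_cvg_series_exp_coeff.
apply/nondecreasing_seqP => k.
by rewrite seriesSr lerDl /exp_coeff/= divr_ge0// exprn_ge0.
Qed.

(** Term-by-term integration of a power series whose coefficients are at most [1 / i!], a form that
    covers cosine and sine alike. For [|x| <= 1] the partial sums at [x s] are bounded by [e^|s|],
    exactly the decay rate assumed of [f]. *)
Let moments_series (x : R) f (c : nat -> R) (h : R -> R) : `|x| <= 1 -> exp_decay 1 f ->
  (forall n, \int[mu]_s (s ^+ n * f s) = 0) ->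
  (forall n, intble (fun s => s ^+ n * f s)) ->
  (forall i, `|c i| <= 1) ->
  (forall y, \sum_(0 <= i < n) c i * y ^+ i / i`!%:R @[n --> \oo] --> h y) ->
  \int[mu]_s (f s * h (x * s)) = 0.
Proof.
move=> x1 [mf intf] f0 intX c1 ch.
apply: (@Rintegral_eq0_dominated _ _ _ mu
  (fun n s => f s * \sum_(0 <= i < n) c i * (x * s) ^+ i / i`!%:R) _
  (fun s => `|f s * expR (1 * `|s|)|)).
- move=> n; apply: measurable_funM => //; apply: measurable_sum => i.
  apply: measurable_funM; last exact: measurable_cst.
  apply: measurable_funM; first exact: measurable_cst.
  by apply: measurable_funX; apply: measurable_funM => //; exact: measurable_cst.
- by move=> s; apply: cvgM; [exact: cvg_cst|exact: ch].
- exact: integrable_norm.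
- move=> n s; rewrite !normrM ler_wpM2l// (ger0_norm (expR_ge0 _)) mul1r.
  rewrite (le_trans (partial_exp_le _ _ c1))// ler_expR normrM.
  by rewrite ler_piMl.
- elim=> [|n IH].
    by under eq_Rintegral do rewrite big_geq// mulr0; rewrite Rintegral_cst// mul0r.
  pose a := c n * x ^+ n / n`!%:R.
  transitivity (\int[mu]_s (f s * (\sum_(0 <= i < n) c i * (x * s) ^+ i / i`!%:R) +
      a * (s ^+ n * f s))).
    by apply: eq_Rintegral => s _; rewrite big_nat_recr//= mulrDr exprMn /a; ring.
  have int1 : intble (fun s => f s * (\sum_(0 <= i < n) c i * (x * s) ^+ i / i`!%:R)).
    under eq_fun do rewrite mulr_sumr.
    have := @integrable_sum _ _ _ mu setT measurableT _ (index_iota 0 n) xpredT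
      (fun i s => (c i * x ^+ i / i`!%:R)%:E * (s ^+ i * f s)%:E)%E.
    move=> /(_ (fun i _ => integrableZl measurableT _ (intX i))).
    apply: eq_integrable => // s _; rewrite /= -sumEFin; apply: eq_bigr => i _.
    by rewrite -EFinM; congr EFin; rewrite exprMn; ring.
  have int2 : intble (fun s => a * (s ^+ n * f s)) by exact: (integrableZl measurableT _ (intX n)).
  by rewrite (RintegralD measurableT int1 int2) IH RintegralZl// f0 mulr0 addr0.
Qed.

Lemma moments0_cos_sin (x : R) f : `|x| <= 1 -> exp_decay 1 f ->
  (forall n, \int[mu]_s (s ^+ n * f s) = 0) ->
  (forall n, intble (fun s => s ^+ n * f s)) ->
  \int[mu]_s (f s * cos (x * s)) = 0 /\ \int[mu]_s (f s * sin (x * s)) = 0.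
Proof.
move=> x1 df f0 intX; split.
- apply: (moments_series (c := fun i => (~~ odd i)%:R * (-1) ^+ i./2)) => // [i|y].
    rewrite normrM normrX normrN1 expr1n mulr1.
    by case: (odd i); rewrite ?normr0 ?normr1.
  rewrite cos.unlock (_ : (fun n => _) = series (cos_coeff y)); last exact/funext.
  exact: is_cvg_series_cos_coeff.
- apply: (moments_series (c := fun i => (odd i)%:R * (-1) ^+ i.-1./2)) => // [i|y].
    rewrite normrM normrX normrN1 expr1n mulr1.
    by case: (odd i); rewrite ?normr0 ?normr1.
  rewrite sin.unlock (_ : (fun n => _) = series (sin_coeff y)); last exact/funext.
  exact: is_cvg_series_sin_coeff.
Qed.

End ExponentialDecay.

(** * Analytic continuation *)

Section AnalyticContinuation.
Context {R : realType}.
Local Notation mu := (@lebesgue_measure R).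
Implicit Types (f g u : R -> R).

Local Notation intble f := (mu.-integrable setT (EFin \o (f : R -> R))).
Local Notation Fre f1 f2 := (fourier_re mu f1 f2 id).
Local Notation Fim f1 f2 := (fourier_im mu f1 f2 id).
Local Notation "f ^s n" := (fun s : R => s ^+ n * f s) (at level 10, n at level 9).

Let mid : measurable_fun setT (id : R -> R).
Proof. exact: measurable_id. Qed.

(** Differentiating [e^(-i y s)] brings down [-i s], and the factor [-i] turns the real part of the
    transform into the imaginary part. Applied to [(u2, - u1)], the same statement differentiates
    the imaginary part. *)
Let is_derive_Fre u1 u2 (y : R) : intble u1 -> intble u2 ->
  intble (u1 ^s 1) -> intble (u2 ^s 1) ->
  is_derive y 1 (Fre u1 u2) (Fim (u1 ^s 1) (u2 ^s 1) y).
Proof.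
move=> i1 i2 j1 j2.
have -> : Fim (u1 ^s 1) (u2 ^s 1) y = \int[mu]_s (s *
    (u2 s * cos (y * s) - u1 s * sin (y * s))).
  by apply: eq_Rintegral => s _; rewrite /= expr1; ring.
apply: (@is_derive_Rintegral _ _ _ mu
  (fun y s => u1 s * cos (y * s) + u2 s * sin (y * s))
  (fun y s => s * (u2 s * cos (y * s) - u1 s * sin (y * s))) y 1
  (fun s => `|s ^+ 1 * u2 s| + `|s ^+ 1 * u1 s|)) => //.
- move=> z.
  have := integrableD measurableT (integrable_mul_cos z i1 mid) (integrable_mul_sin z i2 mid).
  by apply: eq_integrable.
- by move=> z s; apply: is_derive_eq; rewrite /GRing.scale/=; ring.
- have := integrableD measurableT (integrable_norm j2) (integrable_norm j1).
  by apply: eq_integrable.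
- move=> z s _; rewrite expr1 mulrBr (le_trans (ler_normB _ _))// lerD//;
    by rewrite mulrA normrM ler_piMr// ?cos_max ?sin_max.
Qed.

Let Fre_opp u1 u2 y : Fre (\- u1) (\- u2) y = - Fre u1 u2 y.
Proof.
rewrite /fourier_re -RintegralN.
by apply: eq_Rintegral => s _ /=; rewrite !mulNr opprD.
Qed.

Let near_ball (x0 e y : R) : `|y - x0| < e -> \forall z \near y, `|z - x0| < e.
Proof.
move=> ye; apply/nbhs_ballP; exists (e - `|y - x0|); rewrite /= ?subr_gt0// => z.
rewrite -ball_normE/= => yz.
have := ler_normD (y - x0) (z - y); rewrite (distrC z) addrC subrKA; lra.
Qed.

Let derive0_near (F : R -> R) (dF y x0 e : R) : `|y - x0| < e ->
  (forall z, `|z - x0| < e -> F z = 0) -> is_derive y 1 F dF -> dF = 0.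
Proof.
move=> ye F0 dFy; have : is_derive y 1 (cst 0 : R -> R) dF.
  apply: near_eq_is_derive dFy; move: (near_ball ye); apply: filterS => z /F0 ->.
  by [].
by move=> /@derive_val <-; rewrite derive_cst.
Qed.

(** A function that vanishes on a ball has vanishing derivatives there. By induction each derivative
    adds a factor [s] to the density and, up to sign, exchanges real and imaginary parts. *)
Let vanish_moments u1 u2 (x0 e : R) :
  (forall n, intble (u1 ^s n)) -> (forall n, intble (u2 ^s n)) ->
  (forall y, `|y - x0| < e -> Fre u1 u2 y = 0 /\ Fim u1 u2 y = 0) ->
  forall n y, `|y - x0| < e ->
    Fre (u1 ^s n) (u2 ^s n) y = 0 /\ Fim (u1 ^s n) (u2 ^s n) y = 0.
Proof.
move=> i1 i2 h0; elim=> [|n IH] y ye.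
  have E u : (u ^s 0) = u by apply/funext => s; rewrite expr0 mul1r.
  by rewrite !E; exact: h0.
have E u : (u ^s n.+1) = ((u ^s n) ^s 1).
  by apply/funext => s; rewrite expr1 exprS mulrA.
have j1 := i1 n.+1; have j2 := i2 n.+1; rewrite !E in j1 j2 *.
have dre := is_derive_Fre y (i1 n) (i2 n) j1 j2.
have := is_derive_Fre y (i2 n) (integrableN_EFin (i1 n)) j2.
have E' : (\- (u1 ^s n)) ^s 1 = \- ((u1 ^s n) ^s 1).
  by apply/funext => s /=; rewrite mulrN.
rewrite E' => /(_ (integrableN_EFin j1)) dim.
split.
  have := derive0_near ye (fun z ze => (IH z ze).2) dim.
  by rewrite [LHS]Fre_opp// => /eqP; rewrite oppr_eq0 => /eqP.
exact: derive0_near ye (fun z ze => (IH z ze).1) dre.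
Qed.

Let Z f1 f2 (y : R) :=
  forall n, Fre (f1 ^s n) (f2 ^s n) y = 0 /\ Fim (f1 ^s n) (f2 ^s n) y = 0.

(** [Z f1 f2 y] says, up to powers of [-i], that all derivatives of the transform vanish at [y],
    that is, all moments of the density times [e^(-i y s)]. Expanding the second factor of
    [e^(-i (y + x) s) = e^(-i y s) e^(-i x s)] in powers of [x s] propagates this to [y + x]. The
    admissible step 1 does not shrink with [y]. *)
Let Z_step f1 f2 (y x : R) : exp_decay 2 f1 -> exp_decay 2 f2 -> `|x| <= 1 ->
  Z f1 f2 y -> Z f1 f2 (y + x).
Proof.
move=> d1 d2 x1 Zy n.
have mc : measurable_fun setT (fun s : R => cos (y * s)).
  apply: measurableT_comp_continuous; first exact: continuous_cos.
  by apply: measurable_funM => //; exact: measurable_cst.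
have ms : measurable_fun setT (fun s : R => sin (y * s)).
  apply: measurableT_comp_continuous; first exact: continuous_sin.
  by apply: measurable_funM => //; exact: measurable_cst.
(* The real part of [(g1 + i g2) e^(-i y s)]; the pair [(f2, - f1)] gives the imaginary part for
   [(f1, f2)]. *)
pose A g1 g2 (s : R) := g1 s * cos (y * s) + g2 s * sin (y * s).
have decA m g1 g2 : exp_decay 2 g1 -> exp_decay 2 g2 ->
    exp_decay 1 (A (g1 ^s m) (g2 ^s m)).
  move=> e1 e2; apply: exp_decayD.
    by apply: (exp_decayM (M := 1)) (exp_decay_monomial m e1) mc _ => s; exact: cos_max.
  by apply: (exp_decayM (M := 1)) (exp_decay_monomial m e2) ms _ => s; exact: sin_max.
have AX m l g1 g2 : (A (g1 ^s m) (g2 ^s m)) ^s l = A (g1 ^s (l + m)) (g2 ^s (l + m)).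
  by apply/funext => s; rewrite /A exprD; ring.
have step g1 g2 : exp_decay 2 g1 -> exp_decay 2 g2 ->
    (forall m, Fre (g1 ^s m) (g2 ^s m) y = 0) ->
    \int[mu]_s (A (g1 ^s n) (g2 ^s n) s * cos (x * s)) = 0 /\
    \int[mu]_s (A (g1 ^s n) (g2 ^s n) s * sin (x * s)) = 0.
  move=> e1 e2 g0; apply: moments0_cos_sin => //.
  - exact: decA.
  - by move=> l; rewrite AX; exact: g0.
  - by move=> l; rewrite AX; apply: exp_decay_int (decA (l + n)%N _ _ e1 e2).
have NX m : (\- f1) ^s m = \- (f1 ^s m) by apply/funext => s /=; rewrite mulrN.
have nd1 := exp_decayN d1.
have [rc rs] := step _ _ d1 d2 (fun m => (Zy m).1).
have [|ic is_] := step _ _ d2 nd1; first by move=> m; rewrite NX; exact: (Zy m).2.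
have iA g1 g2 : exp_decay 2 g1 -> exp_decay 2 g2 -> intble (A (g1 ^s n) (g2 ^s n)).
  by move=> e1 e2; apply: exp_decay_int (decA n _ _ e1 e2).
have iA1 := iA _ _ d1 d2; have iA2 := iA _ _ d2 nd1.
split.
- transitivity (\int[mu]_s (A (f1 ^s n) (f2 ^s n) s * cos (x * s) +
      A (f2 ^s n) ((\- f1) ^s n) s * sin (x * s))).
    by apply: eq_Rintegral => s _; rewrite /A/= mulrDl cosD sinD; ring.
  rewrite (RintegralD measurableT (integrable_mul_cos x iA1 mid) (integrable_mul_sin x iA2 mid)).
  by rewrite rc is_ addr0.
- transitivity (\int[mu]_s (A (f2 ^s n) ((\- f1) ^s n) s * cos (x * s) -
      A (f1 ^s n) (f2 ^s n) s * sin (x * s))).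
    by apply: eq_Rintegral => s _; rewrite /A/= mulrDl cosD sinD; ring.
  rewrite (RintegralB measurableT (integrable_mul_cos x iA2 mid) (integrable_mul_sin x iA1 mid)).
  by rewrite ic rs subr0.
Qed.

Lemma fourier_vanish_near f1 f2 (x0 e : R) : exp_decay 2 f1 -> exp_decay 2 f2 ->
  0 < e -> (forall y, `|y - x0| < e -> Fre f1 f2 y = 0 /\ Fim f1 f2 y = 0) ->
  forall y, Fre f1 f2 y = 0 /\ Fim f1 f2 y = 0.
Proof.
move=> d1 d2 e0 h0 y.
have iX f : exp_decay 2 f -> forall n, intble (f ^s n).
  by move=> df n; apply: exp_decay_int (exp_decay_monomial n df).
have Z0 : Z f1 f2 x0.
  by move=> n; apply: (vanish_moments (iX _ d1) (iX _ d2) h0); rewrite subrr normr0.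
(* Since [N] exceeds [|y - x0|], [N] equal steps of length at most 1 lead from [x0] to [y]. *)
pose N := (Num.truncn `|y - x0|).+1; pose x := (y - x0) / N%:R.
have N0 : 0 < N%:R :> R by rewrite ltr0n.
have x1 : `|x| <= 1.
  rewrite /x normrM normfV (gtr0_norm N0) ler_pdivrMr// mul1r ltW//.
  exact: truncnS_gt.
have ZN n : Z f1 f2 (x0 + n%:R * x).
  elim: n => [|n IH]; first by rewrite mul0r addr0.
  by rewrite -natr1 mulrDl mul1r addrA; exact: Z_step.
have := ZN N 0%N; rewrite /x mulrCA divff ?gt_eqF// mulr1 addrC subrK.
by have E u : (u ^s 0) = u by [apply/funext => s; rewrite expr0 mul1r]; rewrite !E.
Qed.

(** If the second transform is nonzero at [x0], its squared modulus is positive on a ball by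
    continuity. Squared moduli multiply, so the first transform vanishes on that ball, and analytic
    continuation spreads this to the whole line. *)
Lemma fourier_dichotomy f1 f2 g1 g2 :
  exp_decay 2 f1 -> exp_decay 2 f2 -> exp_decay 2 g1 -> exp_decay 2 g2 ->
  (forall y, Fre f1 f2 y * Fre g1 g2 y - Fim f1 f2 y * Fim g1 g2 y = 0 /\
             Fre f1 f2 y * Fim g1 g2 y + Fim f1 f2 y * Fre g1 g2 y = 0) ->
  (forall y, Fre f1 f2 y = 0 /\ Fim f1 f2 y = 0) \/
  (forall y, Fre g1 g2 y = 0 /\ Fim g1 g2 y = 0).
Proof.
move=> df1 df2 dg1 dg2 fg0.
have [[x0 gx0]|/forallNP g0] :=
    pselect (exists y, ~ (Fre g1 g2 y = 0 /\ Fim g1 g2 y = 0)); last first.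
  by right => y; apply: contrapT; exact: g0.
left.
have iX f : exp_decay 2 f -> intble (f ^s 1).
  by move=> df; apply: exp_decay_int (exp_decay_monomial 1 df).
have i0 f : exp_decay 2 f -> intble f by apply: exp_decay_int.
have cre u1 u2 : exp_decay 2 u1 -> exp_decay 2 u2 -> {for x0, continuous (Fre u1 u2)}.
  move=> d1 d2; apply: differentiable_continuous; apply/derivable1_diffP.
  by have [] := is_derive_Fre x0 (i0 _ d1) (i0 _ d2) (iX _ d1) (iX _ d2).
pose S y := Fre g1 g2 y * Fre g1 g2 y + Fim g1 g2 y * Fim g1 g2 y.
have cS : {for x0, continuous S}.
  have cim : {for x0, continuous (Fim g1 g2)} by apply: cre => //; exact: exp_decayN.
  have cre' := cre _ _ dg1 dg2.
  by apply: cvgD; apply: cvgM.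
have S0 : 0 < S x0.
  rewrite /S -!expr2 lt_neqAle eq_sym addr_ge0 ?sqr_ge0// andbT; apply/negP.
  by rewrite paddr_eq0 ?sqr_ge0// !sqrf_eq0 => /andP[/eqP ? /eqP ?]; exact: gx0.
have /nbhs_ballP[e /= e0 eS] : \forall y \near x0, 0 < S y.
  by apply: (cvgr_gt _ cS).
apply: (fourier_vanish_near (x0 := x0) (e := e)) => // y ye.
have /eS : ball x0 e y by rewrite -ball_normE/= distrC.
rewrite /S -!expr2; have [] := fg0 y.
set a := Fre f1 f2 y; set b := Fim f1 f2 y.
set c := Fre g1 g2 y; set dd := Fim g1 g2 y => e1 e2 cd0.
have : (a ^+ 2 + b ^+ 2) * (c ^+ 2 + dd ^+ 2) = 0.
  rewrite (_ : _ * _ = (a * c - b * dd) ^+ 2 + (a * dd + b * c) ^+ 2); last by ring.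
  by rewrite e1 e2 expr0n addr0.
move=> /eqP; rewrite mulf_eq0 (gt_eqF cd0) orbF.
by rewrite paddr_eq0 ?sqr_ge0// !sqrf_eq0 => /andP[/eqP ? /eqP ?].
Qed.

Lemma fourier_pair_ae f1 f2 : exp_decay 2 f1 -> exp_decay 2 f2 ->
  (forall y, Fre f1 f2 y = 0 /\ Fim f1 f2 y = 0) ->
  {ae mu, forall s, f1 s = 0} /\ {ae mu, forall s, f2 s = 0}.
Proof.
move=> d1 d2 f0.
have i1 : intble f1 by apply: exp_decay_int d1.
have i2 : intble f2 by apply: exp_decay_int d2.
by have [] := fourier_null_pair i1 i2 mid f0; split; exact: fourier_null_id_ae.
Qed.

End AnalyticContinuation.

(** * Fubini's theorem for real-valued integrals *)

Section RealFubini.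
Context d1 d2 (T1 : measurableType d1) (T2 : measurableType d2) (R : realType).
Variable m1 : {sigma_finite_measure set T1 -> \bar R}.
Variable m2 : {sigma_finite_measure set T2 -> \bar R}.

Lemma integrable_prod (f : T1 -> R) (g : T2 -> R) :
  m1.-integrable setT (EFin \o f) -> m2.-integrable setT (EFin \o g) ->
  (m1 \x m2)%E.-integrable setT (EFin \o (fun z => f z.1 * g z.2)).
Proof.
move=> intf intg.
have mf := integrable_measurable intf; have mg := integrable_measurable intg.
have mfg : measurable_fun setT (fun z : T1 * T2 => f z.1 * g z.2).
  apply: measurable_funM.
    exact: measurableT_comp mf measurable_fst.
  exact: measurableT_comp mg measurable_snd.
have mfgE : measurable_fun setT (EFin \o (fun z : T1 * T2 => f z.1 * g z.2)).
  exact/measurable_EFinP.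
apply/(integrable12ltyP _ _ mfgE).
have /integrableP[_ fy] := intf; have /integrableP[_ gy] := intg.
pose C := (\int[m2]_y `|(g y)%:E|)%E.
have Cfin : C \is a fin_num by rewrite ge0_fin_numE// integral_ge0.
have -> : (\int[m1]_x \int[m2]_y `|(f x * g y)%R%:E| =
    \int[m1]_x (C * `|(f x)%:E|))%E.
  apply: eq_integral => x _; rewrite muleC -ge0_integralZl//.
  - by apply: eq_integral => y _ /=; rewrite normrM EFinM.
  - by apply/measurable_EFinP/measurableT_comp.
rewrite ge0_integralZl//.
- by rewrite lte_mul_pinfty// integral_ge0.
- by apply/measurable_EFinP/measurableT_comp.
- exact: integral_ge0.
Qed.

Variable f : T1 * T2 -> R.
Hypothesis intf : (m1 \x m2)%E.-integrable setT (EFin \o f).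

Lemma Rintegral_fubini1 :
  \int[m1]_x \int[m2]_y f (x, y) = \int[(m1 \x m2)%E]_z f z.
Proof.
rewrite [RHS]/Rintegral -(integral12_prod_meas1 intf); congr fine.
have mF := measurable_fubini_F intf.
apply: ae_eq_integral => //.
  by apply/measurable_EFinP; apply: measurableT_comp; first exact: fine_measurable.
(* The section integrals are finite only for almost every [x], so [fine] can change them on a null
   set at most. *)
have := ae_integrable1 intf; apply: filterS => x ix _.
by rewrite /Rintegral fineK//; exact: integrable_fin_num.
Qed.

Lemma Rintegral_fubini2 :
  \int[m2]_y \int[m1]_x f (x, y) = \int[(m1 \x m2)%E]_z f z.
Proof.
rewrite [RHS]/Rintegral -(integral21_prod_meas1 intf); congr fine.
have mF := measurable_fubini_G intf.
apply: ae_eq_integral => //.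
  by apply/measurable_EFinP; apply: measurableT_comp; first exact: fine_measurable.
have := ae_integrable2 intf; apply: filterS => x ix _.
by rewrite /Rintegral fineK//; exact: integrable_fin_num.
Qed.

End RealFubini.

(** * Injectivity of the Mellin transform *)

Section IntervalIntegrals.
Context {R : realType}.
Local Notation mu := (@lebesgue_measure R).
Implicit Types (f F u : R -> R).

Local Notation intble f := (mu.-integrable setT (EFin \o (f : R -> R))).

Lemma Rintegral_indicM (A : set R) f :
  \int[mu]_(x in A) f x = \int[mu]_x (f x * \1_A x).
Proof. by rewrite /Rintegral integral_indicM. Qed.

Lemma measurable_inv : measurable_fun setT (fun x : R => x^-1).
Proof.
(* Squaring makes the base nonnegative, so a real power, whose measurability is known, expresses the
   inverse; at 0 both sides are 0. *)
rewrite (_ : (fun x => _) = (fun x => x * ((x ^+ 2) `^ (-1)))).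
  apply: measurable_funM => //; apply: (measurableT_comp (measurable_powR (-1))).
  exact: measurable_funX.
apply/funext => x; rewrite powR_inv1 ?sqr_ge0//.
have [->|x0] := eqVneq x 0; first by rewrite invr0 mul0r.
by field.
Qed.

Lemma integral_is_derive f F (a b : R) : a < b ->
  (forall x, a <= x <= b -> is_derive x 1 F (f x)) ->
  {in `[a, b]%classic, continuous f} ->
  (\int[mu]_(x in `[a, b]) (f x)%:E = (F b - F a)%:E)%E.
Proof.
move=> ab dF cf.
have cF x : a <= x <= b -> F y @[y --> x] --> F x.
  move=> xab; apply: differentiable_continuous; apply/derivable1_diffP.
  by have [] := dF _ xab.
rewrite EFinB; apply: continuous_FTC2 => //.
- exact: continuous_in_subspaceT.
- split.
  + by move=> x; rewrite in_itv/= => /andP[ax xb]; have [] := dF x; rewrite ?ltW.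
  + by apply: cvg_at_right_filter; apply: cF; rewrite lexx ltW.
  + by apply: cvg_at_left_filter; apply: cF; rewrite lexx ltW.
- move=> x; rewrite in_itv/= => /andP[ax xb]; rewrite derive1E.
  by apply: derive_val; apply: dF; rewrite !ltW.
Qed.

Lemma continuous_cosMr (y : R) : continuous (fun t : R => cos (t * y)).
Proof.
move=> x; have cy : {for x, continuous (fun t : R => t * y)}.
  by apply: cvgM; [exact: cvg_id|exact: cvg_cst].
by apply: (continuous_comp cy); exact: continuous_cos.
Qed.

Lemma continuous_sinMr (y : R) : continuous (fun t : R => sin (t * y)).
Proof.
move=> x; have cy : {for x, continuous (fun t : R => t * y)}.
  by apply: cvgM; [exact: cvg_id|exact: cvg_cst].
by apply: (continuous_comp cy); exact: continuous_sin.
Qed.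

(** The Fourier transform of the indicator of [[-h, h]]; the branch at 0 is its continuous value
    there. *)
Definition sinc2 (h y : R) := if y == 0 then 2 * h else 2 * sin (h * y) / y.

Lemma measurable_sinc2 (h : R) : measurable_fun setT (sinc2 h).
Proof.
apply: measurable_fun_ifT.
- by apply: measurable_fun_eqr => //; exact: measurable_cst.
- exact: measurable_cst.
- apply: measurable_funM; last exact: measurable_inv.
  apply: measurable_funM; first exact: measurable_cst.
  apply: measurableT_comp_continuous; first exact: continuous_sin.
  by apply: measurable_funM => //; exact: measurable_cst.
Qed.

Lemma Rintegral_cos_itv (b h y : R) : 0 < h ->
  \int[mu]_(t in `[b - h, b + h]) cos (t * y) = cos (b * y) * sinc2 h y.
Proof.
move=> h0; have bh : b - h < b + h by lra.
rewrite /Rintegral /sinc2; have [->|y0] := eqVneq y 0.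
  under eq_integral do rewrite mulr0 cos0.
  rewrite integral_cst//= lebesgue_measure_itv/= lte_fin bh mul1e/=.
  by rewrite mulr0 cos0 mul1r; ring.
pose F t := sin (t * y) / y.
rewrite (_ : (\int[mu]_(x in _) _)%E = (F (b + h) - F (b - h))%:E)/=.
  by rewrite /F mulrDl mulrBl sinD sinB; field.
apply: (integral_is_derive (F := F)) => //.
- by move=> x _; rewrite /F; apply: is_derive_eq; rewrite /GRing.scale/=; field.
- by move=> x _; exact: continuous_cosMr.
Qed.

Lemma Rintegral_sin_itv (b h y : R) : 0 < h ->
  \int[mu]_(t in `[b - h, b + h]) sin (t * y) = sin (b * y) * sinc2 h y.
Proof.
move=> h0; have bh : b - h < b + h by lra.
rewrite /Rintegral /sinc2; have [->|y0] := eqVneq y 0.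
  under eq_integral do rewrite mulr0 sin0.
  by rewrite integral0/= mulr0 sin0 mul0r.
pose F t := - cos (t * y) / y.
rewrite (_ : (\int[mu]_(x in _) _)%E = (F (b + h) - F (b - h))%:E)/=.
  by rewrite /F mulrDl mulrBl cosD cosB; field.
apply: (integral_is_derive (F := F)) => //.
- by move=> x _; rewrite /F; apply: is_derive_eq; rewrite /GRing.scale/=; field.
- by move=> x _; exact: continuous_sinMr.
Qed.

(** The sum of two bounds: [|y sinc2 h y| <= 2] from [|sin| <= 1], and [|sinc2 h y| <= 2 h] from the
    integral of a cosine over an interval of length [2 h]. *)
Lemma sinc2_bound (h y : R) : 0 < h -> sinc2 h y ^+ 2 * (1 + y ^+ 2) <= 4 * h ^+ 2 + 4.
Proof.
move=> h0; have [y0|y0] := eqVneq y 0.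
  by rewrite /sinc2 y0 eqxx expr0n addr0 mulr1; nra.
have s1 : (sinc2 h y * y) ^+ 2 <= 4.
  rewrite /sinc2 (negbTE y0) divfK// exprMn -[X in _ <= X]mulr1.
  rewrite (_ : 2 ^+ 2 = 4); last by ring.
  by rewrite ler_wpM2l// sin2cos2 gerBl sqr_ge0.
have s2 : sinc2 h y ^+ 2 <= 4 * h ^+ 2.
  have : `|sinc2 h y| <= 2 * h.
    rewrite (_ : sinc2 h y = \int[mu]_(t in `[0 - h, 0 + h]) cos (t * y)); last first.
      by rewrite Rintegral_cos_itv// mul0r cos0 mul1r.
    have ic : mu.-integrable `[0 - h, 0 + h] (EFin \o (fun t => cos (t * y))).
      apply: continuous_compact_integrable; first exact: segment_compact.
      by apply: continuous_subspaceT; exact: continuous_cosMr.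
    rewrite (le_trans (le_normr_Rintegral _ ic))//.
    apply: (@le_trans _ _ (\int[mu]_(t in `[0 - h, 0 + h]) 1)).
      apply: le_Rintegral => //; first exact: integrable_norm.
        apply: continuous_compact_integrable; first exact: segment_compact.
        by apply: continuous_subspaceT => x; exact: cvg_cst.
      by move=> x _; exact: cos_max.
    rewrite Rintegral_cst//= lebesgue_measure_itv/= lte_fin.
    by case: ifP => _/=; lra.
  by rewrite -(real_normK (num_real (sinc2 _ _))); have := normr_ge0 (sinc2 h y); nra.
by rewrite exprMn in s1; nra.
Qed.

(** In place of the Cauchy-Schwarz inequality, [|T| <= D + T^2 / D] is integrated over [[a, b]].
    With [D = e / (2 (b - a))] the first term contributes [e / 2], and the second at most [e / 2]
    once the integral of the square is below [D e / 2]. *)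
Lemma cvg_Rintegral_itv_of_sqr (T_ : nat -> R -> R) (a b : R) : a < b ->
  (forall n, continuous (T_ n)) ->
  (\int[mu]_t (T_ n t ^+ 2)%:E)%E @[n --> \oo] --> 0%E ->
  \int[mu]_(t in `[a, b]) T_ n t @[n --> \oo] --> 0.
Proof.
move=> ab cT /fine_cvgP[finT cvT].
have iC (g : R -> R) : continuous g -> mu.-integrable `[a, b] (EFin \o g).
  move=> cg; apply: continuous_compact_integrable; first exact: segment_compact.
  exact: continuous_subspaceT.
have cT2 n : continuous (fun t => T_ n t ^+ 2).
  by move=> x; under eq_fun do rewrite expr2; apply: cvgM; exact: cT.
apply/cvgr0Pnorm_le => e e0.
pose D := e / (2 * (b - a)).
have D0 : 0 < D by rewrite divr_gt0// mulr_gt0// subr_gt0.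
have := cvT => /cvgr0_norm_le /(_ (D * (e / 2))) cvT'.
have {}cvT' := cvT' (mulr_gt0 D0 (divr_gt0 e0 (ltr0Sn _ _))).
near=> n.
have fn : (\int[mu]_t (T_ n t ^+ 2)%:E)%E \is a fin_num by near: n; exact: finT.
have Jn : `|fine (\int[mu]_t (T_ n t ^+ 2)%:E)%E| <= D * (e / 2) by near: n; exact: cvT'.
have Jab : \int[mu]_(t in `[a, b]) (T_ n t ^+ 2) <= D * (e / 2).
  apply: le_trans Jn; apply: le_trans (ler_norm _); apply: fine_le => //.
    by apply: integrable_fin_num => //; exact: iC.
  apply: ge0_subset_integral => //.
  - by apply/measurable_EFinP; exact: continuous_measurable_fun (cT2 n).
  - by move=> x _; rewrite lee_fin sqr_ge0.
rewrite (le_trans (le_normr_Rintegral _ (iC _ (cT n))))//.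
have c1 : continuous (fun t : R => D) by move=> x; exact: cvg_cst.
have c2 : continuous (fun t => D^-1 * T_ n t ^+ 2).
  by move=> x; apply: cvgM; [exact: cvg_cst|exact: cT2].
apply: (@le_trans _ _ (\int[mu]_(t in `[a, b]) (D + D^-1 * T_ n t ^+ 2))).
  apply: le_Rintegral => //.
  - exact: integrable_norm (iC _ (cT n)).
  - by apply: iC => x; apply: cvgD; [exact: c1|exact: c2].
  - move=> x _; rewrite -lerBlDl [leRHS]mulrC ler_pdivlMr//.
    rewrite -(real_normK (num_real (T_ n x))); have := normr_ge0 (T_ n x).
    have := sqr_ge0 (`|T_ n x| - D); nra.
rewrite RintegralD//; [|exact: iC|exact: iC].
rewrite Rintegral_cst//= lebesgue_measure_itv/= lte_fin ab/=.
rewrite RintegralZl//; last exact: iC.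
have -> : D * (b - a) = e / 2 by rewrite /D; field; rewrite subr_eq0 gt_eqF.
rewrite -lerBrDl mulrC ler_pdivrMr//; lra.
Unshelve. all: by end_near. Qed.

End IntervalIntegrals.

(** * Uniqueness for densities truncated to growing windows *)

Section MellinPair.
Context {R : realType}.
Local Notation mu := (@lebesgue_measure R).
Implicit Types (f F u : R -> R).

Local Notation intble f := (mu.-integrable setT (EFin \o (f : R -> R))).

Definition window (n : nat) : set R := `[n.+1%:R^-1, n.+1%:R]%classic.

Lemma window_gt0 n t : window n t -> 0 < t.
Proof.
by rewrite /window/= in_itv/= => /andP[+ _]; apply: lt_le_trans; rewrite invr_gt0.
Qed.

Lemma measurable_window n : measurable (window n).
Proof. exact: measurable_itv. Qed.

Lemma subset_window m n : (m <= n)%N -> window m `<=` window n.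
Proof.
move=> mn t; rewrite /window/= !in_itv/= => /andP[a b]; apply/andP; split.
  by apply: le_trans a; rewrite lef_pV2 ?posrE// ler_nat.
by rewrite (le_trans b)// ler_nat.
Qed.

Lemma near_window t : 0 < t -> \forall n \near \oo, window n t.
Proof.
move=> t0; near=> n; rewrite /window/= in_itv/=; apply/andP; split.
  rewrite invf_ple ?posrE// (@le_trans _ _ n%:R)//; last by rewrite ler_nat.
  by near: n; exact: nbhs_infty_ger.
rewrite (@le_trans _ _ n%:R)//; last by rewrite ler_nat.
by near: n; exact: nbhs_infty_ger.
Unshelve. all: by end_near. Qed.

Lemma bigcup_window : \bigcup_n window n = `]0, +oo[%classic.
Proof.
apply/seteqP; split => [t [n _ /window_gt0]|t]; rewrite /= in_itv/= andbT// => t0.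
by have [n _ /(_ n (leqnn n)) nt] := near_window t0; exists n.
Qed.

(** The derivative of [atan (ln t)] on the positive reals, hence of total integral at most [pi]. *)
Let q t : R := (t * (1 + ln t ^+ 2))^-1.

Let q_ge0 t : 0 < t -> 0 <= q t.
Proof. by move=> t0; rewrite invr_ge0 (mulr_ge0 (ltW t0))// addr_ge0// sqr_ge0. Qed.

Let measurable_q : measurable_fun setT q.
Proof.
apply: (measurableT_comp measurable_inv); apply: measurable_funM => //.
apply: measurable_funD; first exact: measurable_cst.
by apply: measurable_funX; exact: measurable_ln.
Qed.

Let integral_q n : (\int[mu]_(t in window n) (q t)%:E <= pi%:E)%E.
Proof.
case: n => [|n].
  (* The window of index 0 is the single point 1, to which the primitive cannot be applied as it
     asks for [a < b]. *)
  by rewrite /window invr1 set_itv1 integral_set1 lee_fin pi_ge0.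
have lt1n : 1 < n.+2%:R :> R by rewrite ltr1n.
pose F t : R := atan (ln t).
have -> : (\int[mu]_(t in window n.+1) (q t)%:E = (F n.+2%:R - F n.+2%:R^-1)%:E)%E.
  apply: integral_is_derive => //.
  - by rewrite (lt_trans _ lt1n)// invf_lt1// (lt_trans _ lt1n).
  - move=> t /andP[tn _]; have t0 : 0 < t by rewrite (lt_le_trans _ tn)// invr_gt0.
    have ? := is_derive1_ln t0.
    by rewrite /F; apply: is_derive_eq; rewrite /q invfM mulrC.
  - move=> t /set_mem/window_gt0 t0.
    apply: cvgV; first by rewrite mulf_neq0 ?gt_eqF// ltr_pwDl// sqr_ge0.
    have cl := continuous_ln t0.
    apply: cvgM; first exact: cvg_id.
    apply: cvgD; first exact: cvg_cst.
    by under eq_fun do rewrite expr2; apply: cvgM.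
rewrite lee_fin /F.
have := atan_ltpi2 (ln n.+2%:R : R); have := atan_gtNpi2 (ln n.+2%:R^-1 : R); lra.
Qed.

Let integrable_q : intble (fun t => q t * \1_(`]0, +oo[%classic : set R) t).
Proof.
have m0 : measurable (`]0, +oo[%classic : set R) by exact: measurable_itv.
apply/integrableP; split.
  by apply/measurable_EFinP; apply: measurable_funM => //; exact: measurable_indic.
have -> : (\int[mu]_t `|(EFin \o (fun t => q t * \1_(`]0, +oo[%classic : set R) t)%R) t| =
    \int[mu]_(t in \bigcup_n window n) (q t)%:E)%E.
  rewrite bigcup_window [RHS]integral_indicM; apply: eq_integral => t _ /=.
  rewrite ger0_norm// indicE; have [|_] := boolP (t \in _); last by rewrite mulr0.
  by rewrite inE/= in_itv/= andbT mulr1 => /q_ge0.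
apply: (@le_lt_trans _ _ pi%:E); last exact: ltry.
have cv : (\int[mu]_(t in window n) (q t)%:E)%E @[n --> \oo] -->
    (\int[mu]_(t in \bigcup_n window n) (q t)%:E)%E.
  apply: ge0_nondecreasing_set_cvg_integral.
  - by move=> m n mn; apply/subsetPset; exact: subset_window.
  - exact: measurable_window.
  - by move=> n; apply/measurable_EFinP; apply: measurable_funTS.
  - by move=> n t /window_gt0 /q_ge0; rewrite /= lee_fin.
rewrite -(cvg_lim _ cv)//; apply: lime_le; first by apply/cvg_ex; eexists; exact: cv.
by apply: nearW => n; exact: integral_q.
Qed.

(** With the weight [t] split between the two factors, [|u sinc2| <= t u^2 + sinc2^2 / t]. The first
    term is integrable by hypothesis, and the second is at most [C * q t] by [sinc2_bound], from
    which [C] is taken. *)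
Lemma integrable_mul_sinc2 u (h : R) : 0 < h -> measurable_fun setT u ->
  (forall t, t <= 0 -> u t = 0) -> intble (fun t => t * u t ^+ 2) ->
  intble (fun t => u t * sinc2 h (ln t)).
Proof.
move=> h0 m_u neg sq; pose C := 4 * h ^+ 2 + 4.
have iS : intble (fun t => t * u t ^+ 2 + C * (q t * \1_(`]0, +oo[%classic : set R) t)).
  have := integrableD measurableT sq (integrableZl measurableT C integrable_q).
  by apply: eq_integrable.
apply: integrable_le_norm iS _ => [|t].
  apply: measurable_funM => //.
  exact: (measurableT_comp (measurable_sinc2 h) (@measurable_ln R)).
have [t0|t0] := leP t 0; first by rewrite neg// mul0r normr0.
have C0 : 0 < C by rewrite /C; have := sqr_ge0 h; lra.
rewrite indicE mem_set ?mulr1; last by rewrite /= in_itv/= t0.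
have qt := q_ge0 t0.
rewrite [leRHS]ger0_norm; last first.
  by rewrite addr_ge0 ?(mulr_ge0 (ltW t0)) ?(mulr_ge0 (ltW C0)) ?sqr_ge0.
have dn : 0 < 1 + ln t ^+ 2 by rewrite ltr_pwDl// sqr_ge0.
have w2 : sinc2 h (ln t) ^+ 2 / t <= C * q t.
  rewrite /q invfM mulrCA [leLHS]mulrC ler_wpM2l ?invr_ge0 ?(ltW t0)// ler_pdivlMr//.
  exact: sinc2_bound.
apply: (@le_trans _ _ (t * u t ^+ 2 + sinc2 h (ln t) ^+ 2 / t)); last by rewrite lerD2l.
rewrite -(ler_pM2l t0) mulrDr [X in _ <= _ + X]mulrC divfK ?gt_eqF//.
rewrite normrM -(real_normK (num_real (u t))) -(real_normK (num_real (sinc2 _ _))).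
have := sqr_ge0 (t * `|u t| - `|sinc2 h (ln t)|).
have := mulr_ge0 (ltW t0) (mulr_ge0 (normr_ge0 (u t)) (normr_ge0 (sinc2 h (ln t)))).
nra.
Qed.

(** From [|u| <= t u^2 + 1 / t], where [1 / t] is at most [n + 1] on the window. *)
Lemma integrable_window u n : measurable_fun setT u ->
  intble (fun t => t * u t ^+ 2) -> intble (fun t => u t * \1_(window n) t).
Proof.
move=> m_u sq.
have iw : intble (fun t => t * u t ^+ 2 + n.+1%:R * \1_(window n) t).
  have iI : intble (\1_(window n) : R -> R) by exact: integrable_indic_itv.
  have := integrableD measurableT sq (integrableZl measurableT n.+1%:R iI).
  by apply: eq_integrable.
apply: integrable_le_norm iw _ => [|t].
  by apply: measurable_funM => //; apply: measurable_indic; exact: measurable_window.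
rewrite indicE; have [|_] := boolP (t \in _); last by rewrite mulr0 normr0.
rewrite inE => wt; have t0 := window_gt0 wt; rewrite /= !mulr1.
rewrite [leRHS]ger0_norm; last by rewrite addr_ge0// ?(mulr_ge0 (ltW t0)) ?sqr_ge0.
have nt : t^-1 <= n.+1%:R.
  by move: wt; rewrite /window/= in_itv/= => /andP[+ _]; rewrite invf_ple ?posrE.
apply: (@le_trans _ _ (t * u t ^+ 2 + t^-1)); last by rewrite lerD2l.
rewrite -(ler_pM2l t0) mulrDr divff ?gt_eqF// -(real_normK (num_real (u t))).
have := sqr_ge0 (t * `|u t| - 1); have := mulr_ge0 (ltW t0) (normr_ge0 (u t)).
nra.
Qed.

Local Notation Fre k1 k2 := (fourier_re mu k1 k2 (@ln R)).

Lemma continuous_fourier_re_ln k1 k2 : intble k1 -> intble k2 -> continuous (Fre k1 k2).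
Proof.
move=> i1 i2 y.
have ig : intble (fun t => `|k1 t| + `|k2 t|).
  have := integrableD measurableT (integrable_norm i1) (integrable_norm i2).
  by apply: eq_integrable.
apply: (@continuity_under_integral _ _ _ mu
  (fun y t => k1 t * cos (y * ln t) + k2 t * sin (y * ln t)) setT measurableT
  (y - 1) (y + 1) _ _ (fun t => `|k1 t| + `|k2 t|)) => //.
- move=> x _; have := integrableD measurableT
    (integrable_mul_cos x i1 (@measurable_ln R)) (integrable_mul_sin x i2 (@measurable_ln R)).
  by apply: eq_integrable.
- apply: aeW => t _ x _; apply: cvgD.
    by apply: cvgM; [exact: cvg_cst|exact: continuous_cosMr].
  by apply: cvgM; [exact: cvg_cst|exact: continuous_sinMr].
- move=> x _; apply: aeW => t _; rewrite (le_trans (ler_normD _ _))//.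
  by rewrite lerD// normrM ler_piMr// ?cos_max ?sin_max.
- by apply/mem_set; rewrite /= in_itv/=; lra.
Qed.

(** Fubini: integrating the kernel [e^(-i y ln t)] over [y] in [[b - h, b + h]] produces
    [e^(-i b ln t)] times [sinc2 h (ln t)]. *)
Let Rintegral_Fre k1 k2 (b h : R) : 0 < h -> intble k1 -> intble k2 ->
  \int[mu]_(y in `[b - h, b + h]) Fre k1 k2 y =
  Fre (fun t => k1 t * sinc2 h (ln t)) (fun t => k2 t * sinc2 h (ln t)) b.
Proof.
move=> h0 i1 i2.
pose I : set R := `[b - h, b + h]%classic.
pose K (z : R * R) := (k1 z.2 * cos (z.1 * ln z.2) + k2 z.2 * sin (z.1 * ln z.2)) * \1_I z.1.
have iI : intble (\1_I : R -> R) by exact: integrable_indic_itv.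
have ig : intble (fun t => `|k1 t| + `|k2 t|).
  have := integrableD measurableT (integrable_norm i1) (integrable_norm i2).
  by apply: eq_integrable.
have mln2 : measurable_fun setT (fun z : R * R => z.1 * ln z.2).
  apply: measurable_funM; first exact: measurable_fst.
  exact: (measurableT_comp (@measurable_ln R) measurable_snd).
have mk k : intble k -> measurable_fun setT (fun z : R * R => k z.2).
  by move=> ik; exact: (measurableT_comp (integrable_measurable ik) measurable_snd).
have intK : (mu \x mu)%E.-integrable setT (EFin \o K).
  apply: integrable_le_norm (integrable_prod iI ig) _ => [|[y t]].
    apply: measurable_funM; last first.
      by apply: (measurableT_comp _ measurable_fst); apply: measurable_indic; exact: measurable_itv.
    apply: measurable_funD; apply: measurable_funM; do ?exact: mk.
      by apply: measurableT_comp_continuous => //; exact: continuous_cos.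
    by apply: measurableT_comp_continuous => //; exact: continuous_sin.
  rewrite /K/= mulrC !normrM ler_wpM2l// [leRHS]ger0_norm ?addr_ge0//.
  rewrite (le_trans (ler_normD _ _))// lerD// normrM ler_piMr//.
    exact: cos_max.
  exact: sin_max.
have iFre x : intble (fun t => k1 t * cos (x * ln t) + k2 t * sin (x * ln t)).
  have := integrableD measurableT
    (integrable_mul_cos x i1 (@measurable_ln R)) (integrable_mul_sin x i2 (@measurable_ln R)).
  by apply: eq_integrable.
transitivity (\int[mu]_y \int[mu]_t K (y, t)).
  rewrite Rintegral_indicM; apply: eq_Rintegral => y _.
  by rewrite /fourier_re -RintegralZr.
rewrite (Rintegral_fubini1 intK) -(Rintegral_fubini2 intK).
apply: eq_Rintegral => t _; rewrite /K/= -Rintegral_indicM.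
have iC (g : R -> R) : continuous g -> mu.-integrable I (EFin \o g).
  move=> cg; apply: continuous_compact_integrable; first exact: segment_compact.
  exact: continuous_subspaceT.
have ic := iC _ (@continuous_cosMr R (ln t)); have is_ := iC _ (@continuous_sinMr R (ln t)).
have ic' : mu.-integrable I (EFin \o (fun y => k1 t * cos (y * ln t))).
  by apply: (integrableZl _ _ ic); exact: measurable_itv.
have is' : mu.-integrable I (EFin \o (fun y => k2 t * sin (y * ln t))).
  by apply: (integrableZl _ _ is_); exact: measurable_itv.
rewrite (RintegralD _ ic' is'); last exact: measurable_itv.
rewrite (RintegralZl _ _ ic); last exact: measurable_itv.
rewrite (RintegralZl _ _ is_); last exact: measurable_itv.
rewrite Rintegral_cos_itv// Rintegral_sin_itv//; ring.
Qed.

(** Two limits of one sequence, the integrals of the windowed transforms over [[b - h, b + h]]: 0 by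
    mean-square convergence, and the stated transform by dominated convergence, available only after
    the factor [sinc2] has made the full density integrable. *)
Lemma mellin_pair_limit u1 u2 (h b : R) : 0 < h ->
  measurable_fun setT u1 -> measurable_fun setT u2 ->
  (forall t, t <= 0 -> u1 t = 0) -> (forall t, t <= 0 -> u2 t = 0) ->
  intble (fun t => t * u1 t ^+ 2) -> intble (fun t => t * u2 t ^+ 2) ->
  (\int[mu]_y (Fre (fun t => u1 t * \1_(window n) t)
                   (fun t => u2 t * \1_(window n) t) y ^+ 2)%:E)%E @[n --> \oo] --> 0%E ->
  Fre (fun t => u1 t * sinc2 h (ln t)) (fun t => u2 t * sinc2 h (ln t)) b = 0.
Proof.
move=> h0 m1 m2 neg1 neg2 sq1 sq2 J0.
have iw1 n := integrable_window n m1 sq1; have iw2 n := integrable_window n m2 sq2.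
have is1 := integrable_mul_sinc2 h0 m1 neg1 sq1.
have is2 := integrable_mul_sinc2 h0 m2 neg2 sq2.
have bh : b - h < b + h by lra.
have := cvg_Rintegral_itv_of_sqr bh (fun n => continuous_fourier_re_ln (iw1 n) (iw2 n)) J0.
under eq_fun do rewrite Rintegral_Fre//.
move=> cv0; apply: cvg_unique cv0.
  exact: Rhausdorff.
pose k1 t := u1 t * sinc2 h (ln t); pose k2 t := u2 t * sinc2 h (ln t).
have m_ln := @measurable_ln R.
have iF : intble (fun t => k1 t * cos (b * ln t) + k2 t * sin (b * ln t)).
  have := integrableD measurableT (integrable_mul_cos b is1 m_ln) (integrable_mul_sin b is2 m_ln).
  by apply: eq_integrable.
pose F t := k1 t * cos (b * ln t) + k2 t * sin (b * ln t).
have E n : Fre (fun t => u1 t * \1_(window n) t * sinc2 h (ln t))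
    (fun t => u2 t * \1_(window n) t * sinc2 h (ln t)) b =
    \int[mu]_t (F t * \1_(window n) t).
  by apply: eq_Rintegral => t _; rewrite /F /k1 /k2; ring.
rewrite (_ : (fun n => _) = (fun n => \int[mu]_t (F t * \1_(window n) t))); last first.
  by apply/funext => n; exact: E.
apply: (@Rintegral_dominated_cvg _ _ _ mu _ _ (fun t => `|F t|)).
- move=> n; apply: measurable_funM; first exact: integrable_measurable iF.
  by apply: measurable_indic; exact: measurable_window.
- move=> t; apply: cvg_near_cst; have [t0|t0] := leP t 0.
    by apply: nearW => n; rewrite /F /k1 /k2 neg1// neg2// !mul0r addr0 mul0r.
  by apply: filterS (near_window t0) => n wt; rewrite indicE mem_set// mulr1.
- exact: integrable_norm iF.
- move=> n t; rewrite normrM ler_piMr// indicE.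
  by case: (_ \in _); rewrite ?normr1 ?normr0.
Qed.

(** With [h = 1 / (n + 1)] and [n + 1 > |y|], the argument [h y] lies in (-1, 1), where [sin]
    vanishes only at 0. Having countably many [h] allows the exceptional null sets to be united
    later. *)
Let sinc2_neq0 (y : R) : exists n : nat, sinc2 n.+1%:R^-1 y != 0.
Proof.
exists (Num.truncn `|y|); set m := (_.+1)%:R.
have m0 : 0 < m by rewrite ltr0n.
rewrite /sinc2; have [y0|y0] := eqVneq y 0.
  by rewrite mulf_neq0 ?invr_eq0 ?gt_eqF.
rewrite mulf_neq0 ?invr_eq0// mulf_neq0//.
have ym : `|y| < m by exact: truncnS_gt.
have ym1 : `|m^-1 * y| < 2.
  rewrite normrM gtr0_norm ?invr_gt0// ltr_pdivrMl//; lra.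
have my0 : m^-1 * y != 0 by rewrite mulf_neq0// invr_eq0 gt_eqF.
move: ym1 my0; set z := m^-1 * y.
have [z0|z0|->] := ltgtP z 0; rewrite ?eqxx// => z2 _.
  rewrite -[z]opprK sinN oppr_eq0 gt_eqF// sin2_gt0//.
  by rewrite oppr_gt0 z0 -(ltr0_norm z0).
by rewrite gt_eqF// sin2_gt0// z0 (le_lt_trans (ler_norm z)).
Qed.

(** The Mellin kernel is [e^(+ i y ln t)], while [fourier_re] and [fourier_im] use [e^(- i y p)].
    The two hypotheses therefore concern the transform of the conjugate density [u1 - i u2]: its
    real part, and its imaginary part with the opposite sign. *)
Lemma mellin_pair_ae u1 u2 :
  measurable_fun setT u1 -> measurable_fun setT u2 ->
  (forall t, t <= 0 -> u1 t = 0) -> (forall t, t <= 0 -> u2 t = 0) ->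
  intble (fun t => t * u1 t ^+ 2) -> intble (fun t => t * u2 t ^+ 2) ->
  (\int[mu]_y (Fre (fun t => u1 t * \1_(window n) t)
                   (fun t => - u2 t * \1_(window n) t) y ^+ 2)%:E)%E @[n --> \oo] --> 0%E ->
  (\int[mu]_y (Fre (fun t => u2 t * \1_(window n) t)
                   (fun t => u1 t * \1_(window n) t) y ^+ 2)%:E)%E @[n --> \oo] --> 0%E ->
  {ae mu, forall t, u1 t = 0 /\ u2 t = 0}.
Proof.
move=> m1 m2 neg1 neg2 sq1 sq2 J1 J2.
have mN2 : measurable_fun setT (\- u2) by exact: measurable_funN.
have negN2 t : t <= 0 -> - u2 t = 0 by move=> /neg2 ->; rewrite oppr0.
have sqN2 : intble (fun t => t * (- u2 t) ^+ 2) by under eq_fun do rewrite sqrrN.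
have H n : {ae mu, forall t, u1 t * sinc2 n.+1%:R^-1 (ln t) = 0 /\
    - u2 t * sinc2 n.+1%:R^-1 (ln t) = 0}.
  have h0 : 0 < n.+1%:R^-1 :> R by rewrite invr_gt0.
  have i1 := integrable_mul_sinc2 h0 m1 neg1 sq1.
  have i2 := integrable_mul_sinc2 h0 mN2 negN2 sqN2.
  have [] := fourier_null_pair i1 i2 (@measurable_ln R).
    move=> b; split; first exact: (mellin_pair_limit b h0 m1 mN2 neg1 negN2 sq1 sqN2 J1).
    rewrite /fourier_im -[RHS]oppr0.
    rewrite -(mellin_pair_limit b h0 m2 m1 neg2 neg1 sq2 sq1 J2).
    by rewrite /fourier_re -RintegralN; apply: eq_Rintegral => t _ /=; ring.
  move=> n1 n2.
  have ae1 := fourier_null_ln_ae i1 _ n1; have ae2 := fourier_null_ln_ae i2 _ n2.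
  have {}ae1 := ae1 (fun t t0 => etrans (congr1 (fun x => x * _) (neg1 t t0)) (mul0r _)).
  have {}ae2 := ae2 (fun t t0 => etrans (congr1 (fun x => x * _) (negN2 t t0)) (mul0r _)).
  move: ae1 ae2; apply: filterS2; first exact: (ae_filter_ringOfSetsType mu).
  by move=> t; split.
have /ae_foralln := H; apply: filterS => t Ht.
have [n /negbTE n0] := sinc2_neq0 (ln t); have [/eqP + /eqP] := Ht n.
by rewrite !mulf_eq0 n0 !orbF oppr_eq0 => /eqP -> /eqP ->.
Qed.

End MellinPair.

(** * The cotangent on vertical lines *)

Section Cotangent.
Context {R : realType}.
Implicit Types (x y t : R) (z w : R[i]).

Lemma cexpE x y : cexp (x +i* y) = (expR x * cos y) +i* (expR x * sin y).
Proof. by rewrite /cexp/=; apply/eqP; rewrite eq_complex/= !mul0r subr0 addr0 !eqxx. Qed.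

Let half_complex x y : (x +i* y) / 2 = (x / 2) +i* (y / 2).
Proof.
apply: (mulIf (x := 2)); first by rewrite pnatr_eq0.
rewrite divfK ?pnatr_eq0// mulr_natr mulr2n.
by apply/eqP; rewrite eq_complex/=; apply/andP; split; apply/eqP; field.
Qed.

(* The real and imaginary parts of cot and tan on the line [Re z = x], from
   [sin z = ((p + q) sin x - i (p - q) cos x) / 2] with [p = e^(-t)], [q = e^t]. *)
Let cosh2 t : R := expR (- t) + expR t.
Let sinh2 t : R := expR (- t) - expR t.
Let den x t : R := (cosh2 t * sin x) ^+ 2 + (sinh2 t * cos x) ^+ 2.
Let den' x t : R := (cosh2 t * cos x) ^+ 2 + (sinh2 t * sin x) ^+ 2.

Definition cot_re x t : R := 4 * cos x * sin x / den x t.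
Definition cot_im x t : R := cosh2 t * sinh2 t / den x t.
Definition tan_re x t : R := 4 * cos x * sin x / den' x t.
Definition tan_im x t : R := - (cosh2 t * sinh2 t / den' x t).

Let ccosE x t : ccos (x +i* t) = (cosh2 t * cos x / 2) +i* (sinh2 t * sin x / 2).
Proof.
rewrite /ccos (_ : 'i * (x +i* t) = (- t) +i* x); last first.
  by apply/eqP; rewrite eq_complex/=; apply/andP; split; apply/eqP; ring.
rewrite (_ : - ((- t) +i* x) = t +i* (- x)); last first.
  by apply/eqP; rewrite eq_complex/= opprK !eqxx.
rewrite !cexpE cosN sinN -half_complex; congr (_ / 2).
by apply/eqP; rewrite eq_complex/=; apply/andP; split; apply/eqP; rewrite /cosh2 /sinh2; ring.
Qed.

Let csinE x t : csin (x +i* t) = (cosh2 t * sin x / 2) +i* (- (sinh2 t * cos x) / 2).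
Proof.
rewrite /csin (_ : 'i * (x +i* t) = (- t) +i* x); last first.
  by apply/eqP; rewrite eq_complex/=; apply/andP; split; apply/eqP; ring.
rewrite (_ : - ((- t) +i* x) = t +i* (- x)); last first.
  by apply/eqP; rewrite eq_complex/= opprK !eqxx.
have i0 : 'i != 0 :> R[i] by rewrite eq_complex/= oner_eq0 andbF.
rewrite !cexpE cosN sinN invfM mulrA; apply: (mulIf i0); rewrite divfK// -half_complex.
rewrite mulrAC; congr (_ / 2).
by apply/eqP; rewrite eq_complex/=; apply/andP; split; apply/eqP; rewrite /cosh2 /sinh2; ring.
Qed.

Let cosh2_ge t : 2 <= cosh2 t.
Proof.
rewrite /cosh2 expRN; have := expR_gt0 t; set e := expR t => e0.
rewrite -(ler_pM2r e0) [leRHS]mulrDl mulVf ?gt_eqF//; have := sqr_ge0 (e - 1); nra.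
Qed.

Let sinh2_le t : `|sinh2 t| <= cosh2 t.
Proof.
rewrite /sinh2 /cosh2 ler_norml; have := expR_gt0 t; have := expR_gt0 (- t); lra.
Qed.

Let cosh2sinh2 t : cosh2 t ^+ 2 - sinh2 t ^+ 2 = 4.
Proof.
rewrite /cosh2 /sinh2 expRN; field; exact: lt0r_neq0 (expR_gt0 t).
Qed.

Let den_ge x t : cosh2 t ^+ 2 * sin x ^+ 2 <= den x t.
Proof. by rewrite /den exprMn lerDl sqr_ge0. Qed.

Let den'_ge x t : cosh2 t ^+ 2 * cos x ^+ 2 <= den' x t.
Proof. by rewrite /den' exprMn lerDl sqr_ge0. Qed.

Let den_gt0 x t : 0 < sin x -> 0 < den x t.
Proof.
move=> s0; apply: lt_le_trans (den_ge x t).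
by rewrite mulr_gt0// exprn_gt0//; have := cosh2_ge t; lra.
Qed.

Let den'_gt0 x t : 0 < cos x -> 0 < den' x t.
Proof.
move=> s0; apply: lt_le_trans (den'_ge x t).
by rewrite mulr_gt0// exprn_gt0//; have := cosh2_ge t; lra.
Qed.

Lemma csin_neq0 x t : 0 < sin x -> csin (x +i* t) != 0.
Proof.
move=> s0; rewrite csinE eq_complex/= negb_and; apply/orP; left.
by rewrite !mulf_neq0 ?invr_eq0 ?gt_eqF//; have := cosh2_ge t; lra.
Qed.

Lemma ccos_neq0 x t : 0 < cos x -> ccos (x +i* t) != 0.
Proof.
move=> s0; rewrite ccosE eq_complex/= negb_and; apply/orP; left.
by rewrite !mulf_neq0 ?invr_eq0 ?gt_eqF//; have := cosh2_ge t; lra.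
Qed.

Lemma ccotE x t : 0 < sin x -> ccot (x +i* t) = cot_re x t +i* cot_im x t.
Proof.
move=> s0; apply: (mulIf (csin_neq0 t s0)); rewrite /ccot divfK ?csin_neq0//.
have d0 : den x t != 0 by rewrite gt_eqF// den_gt0.
rewrite ccosE csinE /cot_re /cot_im; apply/eqP; rewrite eq_complex/=.
have e4 := cosh2sinh2 t; have cs := cos2Dsin2 x.
apply/andP; split; apply/eqP.
(* Once 4 is rewritten as [cosh2^2 - sinh2^2], the difference of the two sides is a multiple of
   [cos^2 + sin^2 - 1]. *)
- have H : cosh2 t * cos x / 2 * den x t = (4 * cos x * sin x * (cosh2 t * sin x) +
      cosh2 t * sinh2 t * (sinh2 t * cos x)) / 2.
    apply/eqP; rewrite -subr_eq0; apply/eqP.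
    transitivity ((cosh2 t * cos x * sinh2 t ^+ 2 / 2) * (cos x ^+ 2 + sin x ^+ 2 - 1));
      last by rewrite cs subrr mulr0.
    by rewrite /den -e4; field.
  by apply: (mulIf d0); rewrite H; field.
- have H : sinh2 t * sin x / 2 * den x t = (cosh2 t * sinh2 t * (cosh2 t * sin x) -
      4 * cos x * sin x * (sinh2 t * cos x)) / 2.
    apply/eqP; rewrite -subr_eq0; apply/eqP.
    transitivity ((sinh2 t * sin x * cosh2 t ^+ 2 / 2) * (cos x ^+ 2 + sin x ^+ 2 - 1));
      last by rewrite cs subrr mulr0.
    by rewrite /den -e4; field.
  by apply: (mulIf d0); rewrite H; field.
Qed.

Lemma ccotVE x t : 0 < sin x -> 0 < cos x ->
  (ccot (x +i* t))^-1 = tan_re x t +i* tan_im x t.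
Proof.
move=> s0 c0; rewrite /ccot invf_div; apply: (mulIf (ccos_neq0 t c0)).
rewrite divfK ?ccos_neq0//.
have d0 : den' x t != 0 by rewrite gt_eqF// den'_gt0.
rewrite ccosE csinE /tan_re /tan_im; apply/eqP; rewrite eq_complex/=.
have e4 := cosh2sinh2 t; have cs := cos2Dsin2 x.
apply/andP; split; apply/eqP.
- have H : cosh2 t * sin x / 2 * den' x t = (4 * cos x * sin x * (cosh2 t * cos x) +
      cosh2 t * sinh2 t * (sinh2 t * sin x)) / 2.
    apply/eqP; rewrite -subr_eq0; apply/eqP.
    transitivity ((cosh2 t * sin x * sinh2 t ^+ 2 / 2) * (cos x ^+ 2 + sin x ^+ 2 - 1));
      last by rewrite cs subrr mulr0.
    by rewrite /den' -e4; field.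
  by apply: (mulIf d0); rewrite H; field.
- have H : - (sinh2 t * cos x) / 2 * den' x t = (4 * cos x * sin x * (sinh2 t * sin x) -
      cosh2 t * sinh2 t * (cosh2 t * cos x)) / 2.
    apply/eqP; rewrite -subr_eq0; apply/eqP.
    transitivity (- (sinh2 t * cos x * cosh2 t ^+ 2 / 2) * (cos x ^+ 2 + sin x ^+ 2 - 1));
      last by rewrite cs subrr mulr0.
    by rewrite /den' -e4; field.
  by apply: (mulIf d0); rewrite H; field.
Qed.

Let measurable_cosh2 : measurable_fun setT cosh2.
Proof.
apply: measurable_funD; last exact: measurable_expR.
by apply: (measurableT_comp (@measurable_expR R)); exact: measurable_funN.
Qed.

Let measurable_sinh2 : measurable_fun setT sinh2.
Proof.
apply: measurable_funB; last exact: measurable_expR.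
by apply: (measurableT_comp (@measurable_expR R)); exact: measurable_funN.
Qed.

Let measurable_den (c s : R) : measurable_fun setT
  (fun t => ((cosh2 t * s) ^+ 2 + (sinh2 t * c) ^+ 2)^-1).
Proof.
apply: (measurableT_comp measurable_inv); apply: measurable_funD.
  by apply: measurable_funX; apply: measurable_funM => //; exact: measurable_cst.
by apply: measurable_funX; apply: measurable_funM => //; exact: measurable_cst.
Qed.

Lemma measurable_cot_re x : measurable_fun setT (cot_re x).
Proof. by apply: measurable_funM; [exact: measurable_cst|exact: measurable_den]. Qed.

Lemma measurable_cot_im x : measurable_fun setT (cot_im x).
Proof. by apply: measurable_funM; [exact: measurable_funM|exact: measurable_den]. Qed.

Lemma measurable_tan_re x : measurable_fun setT (tan_re x).
Proof. by apply: measurable_funM; [exact: measurable_cst|exact: measurable_den]. Qed.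

Lemma measurable_tan_im x : measurable_fun setT (tan_im x).
Proof.
apply: measurable_funN.
by apply: measurable_funM; [exact: measurable_funM|exact: measurable_den].
Qed.

(** Since [cosh2] is at least 2, [D >= 4 s^2]. Taking [(c, s)] to be [(cos x, sin x)] serves the
    cotangent, and the exchanged pair serves the tangent. *)
Let re_bound (c s : R) (D : R) t : 0 < s -> cosh2 t ^+ 2 * s ^+ 2 <= D ->
  `|4 * c * s / D| <= `|c| / s.
Proof.
move=> s0 cD; have c2 := cosh2_ge t.
have D0 : 0 < D by apply: lt_le_trans cD; rewrite mulr_gt0// exprn_gt0//; lra.
rewrite !normrM normfV (gtr0_norm s0) (gtr0_norm D0) (gtr0_norm (ltr0Sn _ 3)).
rewrite ler_pdivrMr// [leRHS]mulrAC ler_pdivlMr//.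
have : 4 * s ^+ 2 <= D by apply: le_trans cD; rewrite ler_wpM2r ?sqr_ge0//; nra.
by have := normr_ge0 c; nra.
Qed.

Let im_bound (s D : R) t : 0 < s -> cosh2 t ^+ 2 * s ^+ 2 <= D ->
  `|cosh2 t * sinh2 t / D| <= (s ^+ 2)^-1.
Proof.
move=> s0 cD; have c2 := cosh2_ge t.
have s20 : 0 < s ^+ 2 by rewrite exprn_gt0.
have D0 : 0 < D by apply: lt_le_trans cD; rewrite mulr_gt0// exprn_gt0//; lra.
rewrite !normrM normfV (gtr0_norm D0) ler_pdivrMr// [leRHS]mulrC ler_pdivlMr//.
apply: le_trans cD; rewrite ler_wpM2r ?(ltW s20)//.
rewrite ger0_norm; last by lra.
by rewrite expr2 ler_wpM2l ?sinh2_le//; lra.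
Qed.

Lemma cot_bounded x : 0 < sin x -> 0 < cos x -> exists M : R, forall t,
  [/\ `|cot_re x t| <= M, `|cot_im x t| <= M, `|tan_re x t| <= M & `|tan_im x t| <= M].
Proof.
move=> s0 c0; set M1 := `|cos x| / sin x; set M2 := (sin x ^+ 2)^-1.
set M3 := `|sin x| / cos x; set M4 := (cos x ^+ 2)^-1.
have p1 : 0 <= M1 by rewrite divr_ge0// ltW.
have p2 : 0 <= M2 by rewrite invr_ge0 sqr_ge0.
have p3 : 0 <= M3 by rewrite divr_ge0// ltW.
have p4 : 0 <= M4 by rewrite invr_ge0 sqr_ge0.
exists (M1 + M2 + M3 + M4) => t.
have b1 : `|cot_re x t| <= M1 by apply: re_bound => //; exact: den_ge.
have b2 : `|cot_im x t| <= M2 by apply: im_bound => //; exact: den_ge.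
have b3 : `|tan_re x t| <= M3.
  by rewrite /tan_re -(mulrAC _ (sin x)); apply: re_bound => //; exact: den'_ge.
have b4 : `|tan_im x t| <= M4.
  by rewrite normrN; apply: im_bound => //; exact: den'_ge.
by split; lra.
Qed.

Lemma ccot_neq0 x t : 0 < sin x -> 0 < cos x -> ccot (x +i* t) != 0.
Proof. by move=> s0 c0; rewrite mulf_neq0 ?invr_eq0 ?ccos_neq0 ?csin_neq0. Qed.

End Cotangent.

(** * Injectivity of the Mellin transform on the space [mellin_L2] *)

Section MellinUniqueness.
Context {R : realType}.
Local Notation mu := (@lebesgue_measure R).

Local Notation intble f := (mu.-integrable setT (EFin \o (f : R -> R))).

Lemma normc_sqr (z : R[i]) : normc z ^+ 2 = complex.Re z ^+ 2 + complex.Im z ^+ 2.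
Proof. by case: z => x y /=; rewrite sqr_sqrtr// addr_ge0// sqr_ge0. Qed.

Lemma mellin_unique (a : R) (f : R -> R[i]) (F : R[i] -> R[i]) :
  mellin_L2 a f -> is_mellin a f F -> {ae mu, forall t : R, F (a +i* t) = 0} ->
  {ae mu, forall x : R, 0 < x -> f x = 0}.
Proof.
move=> [[mRe mIm] fL2] [[[mFRe mFIm] _] cvF] F0.
pose D : set R := `]0, +oo[%classic.
have mD : measurable D by exact: measurable_itv.
pose e (t : R) := expR ((a - 1) * ln t).
have m_e : measurable_fun setT e.
  apply: (measurableT_comp (@measurable_expR R)).
  by apply: measurable_funM; [exact: measurable_cst|exact: measurable_ln].
(* With [e t = t^(a - 1)], this is the density of the Mellin transform in the variable [ln t],
   extended by 0 to the whole line. *)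
pose part (r : R -> R) : R -> R := (fun t => r t * e t) \_ D.
have partE r t : 0 < t -> part r t = r t * e t.
  by move=> t0; rewrite /part patchE mem_set// /D/= in_itv/= t0.
have part_neg r t : t <= 0 -> part r t = 0.
  move=> t0; rewrite /part patchE memNset// /D/= in_itv/= andbT; apply/negP.
  by rewrite -leNgt.
have mpart r : measurable_fun D r -> measurable_fun setT (part r).
  move=> mr; apply/(measurable_restrictT _ mD); apply: measurable_funM => //.
  exact: measurable_funTS.
pose g t := normc (f t) ^+ 2 * t `^ (2 * a - 1).
have mg : measurable_fun D g.
  apply: measurable_funM.
    under eq_fun do rewrite normc_sqr.
    by apply: measurable_funD; exact: measurable_funX.
  by apply: measurable_funTS; exact: measurable_powR.
have g0 t : 0 <= g t by rewrite mulr_ge0 ?sqr_ge0// powR_ge0.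
have ig : intble (g \_ D).
  rewrite -restrict_EFin; apply/integrable_restrict => //; rewrite setTI.
  apply/integrableP; split; first exact/measurable_EFinP.
  apply: le_lt_trans fL2; rewrite le_eqVlt; apply/orP; left; apply/eqP.
  by apply: eq_integral => t _ /=; rewrite ger0_norm.
have sq_part (r : R -> R) : measurable_fun D r ->
    (forall t, r t ^+ 2 <= normc (f t) ^+ 2) -> intble (fun t => t * part r t ^+ 2).
  move=> mr rf; apply: (integrable_le_norm _ ig) => [|t].
    by apply: measurable_funM => //; apply: measurable_funX; exact: mpart.
  have [t0|t0] := leP t 0; first by rewrite part_neg// expr0n mulr0 normr0.
  rewrite partE// patchE mem_set/=; last by rewrite /D/= in_itv/= t0.
  rewrite [leRHS]ger0_norm// ger0_norm; last by rewrite mulr_ge0 ?sqr_ge0 ?ltW.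
  rewrite /g exprMn mulrCA ler_pM ?sqr_ge0//.
    by rewrite mulr_ge0 ?sqr_ge0 ?ltW.
  (* The exponents agree, [t (t^(a - 1))^2 = t^(2 a - 1)]: the weight of [mellin_L2] is the one
     under which [t u^2] is integrable. *)
  rewrite /powR gt_eqF// /e -expRM_natl -[X in X * _](lnK t0) -expRD ler_expR.
  by lra.
pose f1 t := complex.Re (f t); pose f2 t := complex.Im (f t).
have sq1 := sq_part f1 mRe _; have sq2 := sq_part f2 mIm _.
have {}sq1 : intble (fun t => t * part f1 t ^+ 2).
  by apply: sq1 => t; rewrite normc_sqr lerDl sqr_ge0.
have {}sq2 : intble (fun t => t * part f2 t ^+ 2).
  by apply: sq2 => t; rewrite normc_sqr lerDr sqr_ge0.
have m1 := mpart f1 mRe; have m2 := mpart f2 mIm.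
pose Tre n := fourier_re mu (fun t => part f1 t * \1_(window n) t)
  (fun t => - part f2 t * \1_(window n) t) (@ln R).
pose Tim n := fourier_re mu (fun t => part f2 t * \1_(window n) t)
  (fun t => part f1 t * \1_(window n) t) (@ln R).
have truncE n y : mellin_trunc f n.+1%:R (a +i* y) = Tre n y +i* Tim n y.
  have kE t : window n t -> f t * cpow t ((a +i* y) - 1) =
      (part f1 t * cos (y * ln t) - part f2 t * sin (y * ln t)) +i*
      (part f2 t * cos (y * ln t) + part f1 t * sin (y * ln t)).
    move=> wt; have t0 := window_gt0 wt; rewrite !partE// /cpow.
    rewrite (_ : _ * (ln t)%:C = ((a - 1) * ln t) +i* (y * ln t)); last first.
      by apply/eqP; rewrite eq_complex/=; apply/andP; split; apply/eqP; ring.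
    rewrite cexpE -/(e t) /f1 /f2; case: (f t) => x1 x2.
    by apply/eqP; rewrite eq_complex/=; apply/andP; split; apply/eqP; ring.
  apply/eqP; rewrite eq_complex/=; apply/andP; split; apply/eqP.
    rewrite -/(window n) Rintegral_indicM; apply: eq_Rintegral => t _.
    rewrite indicE; have [|_] := boolP (t \in window n); last by rewrite !mulr0 !mul0r addr0.
    by rewrite inE => /kE ->/=; ring.
  rewrite -/(window n) Rintegral_indicM; apply: eq_Rintegral => t _.
  rewrite indicE; have [|_] := boolP (t \in window n); last by rewrite !mulr0 !mul0r addr0.
  by rewrite inE => /kE ->/=; ring.
pose J (X : R) := (\int[mu]_t (normc (F (a +i* t) - mellin_trunc f X (a +i* t)) ^+ 2)%:E)%E.
have J0 : J n.+1%:R @[n --> \oo] --> 0%E.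
  apply: (cvg_comp (fun n => n.+1%:R : R) J _ cvF).
  apply/cvgryPge => A; near=> n; rewrite (@le_trans _ _ n%:R)// ?ler_nat//.
  by near: n; exact: nbhs_infty_ger.
have iw1 n := integrable_window n m1 sq1.
have iw2 n := integrable_window n m2 sq2.
have iwN2 n : intble (fun t => - part f2 t * \1_(window n) t).
  by under eq_fun do rewrite mulNr; exact: integrableN_EFin.
have mTre n : measurable_fun setT (Tre n).
  exact: continuous_measurable_fun (continuous_fourier_re_ln (iw1 n) (iwN2 n)).
have mTim n : measurable_fun setT (Tim n).
  exact: continuous_measurable_fun (continuous_fourier_re_ln (iw2 n) (iw1 n)).
have mJ n : measurable_fun setT
    (fun t : R => (normc (F (a +i* t) - mellin_trunc f n.+1%:R (a +i* t)) ^+ 2)%:E).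
  apply/measurable_EFinP; under eq_fun do rewrite normc_sqr truncE.
  apply: measurable_funD; apply: measurable_funX.
    rewrite (_ : (fun x => _) = (fun t => complex.Re (F (a +i* t)) - Tre n t)).
      exact: measurable_funB.
    by apply/funext => t; case: (F _).
  rewrite (_ : (fun x => _) = (fun t => complex.Im (F (a +i* t)) - Tim n t)).
    exact: measurable_funB.
  by apply/funext => t; case: (F _).
(* As [F] vanishes almost everywhere on the line, the mean-square error [J] is the integral of the
   squared modulus of the truncated transform, which controls its real and imaginary parts
   separately. *)
have squeeze (T_ : nat -> R -> R) : (forall n, measurable_fun setT (T_ n)) ->
    (forall n t, T_ n t ^+ 2 <= Tre n t ^+ 2 + Tim n t ^+ 2) ->
    (\int[mu]_t (T_ n t ^+ 2)%:E)%E @[n --> \oo] --> 0%E.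
  move=> mT T_le; apply: (@squeeze_cvge _ _ _ _ (cst 0%E) _ (fun n => J n.+1%:R)) => //.
    apply: nearW => n; rewrite integral_ge0/=; last by move=> t _; rewrite lee_fin sqr_ge0.
    apply: ae_ge0_le_integral => //.
    - by move=> t _; rewrite lee_fin sqr_ge0.
    - by apply/measurable_EFinP; exact: measurable_funX (mT n).
    - by move=> t _; rewrite lee_fin sqr_ge0.
    - exact: mJ.
    - move: F0; apply: filterS; first exact: (ae_filter_ringOfSetsType mu).
      move=> t Ft _.
      by rewrite lee_fin Ft truncE normc_sqr/= !sub0r !sqrrN.
  exact: cvg_cst.
have J1 := squeeze Tre mTre (fun n t => ler_wpDr (sqr_ge0 _) (lexx _)).
have J2 := squeeze Tim mTim (fun n t => ler_wpDl (sqr_ge0 _) (lexx _)).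
have := mellin_pair_ae m1 m2 (part_neg f1) (part_neg f2) sq1 sq2 J1 J2.
apply: filterS; first exact: (ae_filter_ringOfSetsType mu).
move=> t [+ +] t0; rewrite !partE// => /eqP + /eqP.
rewrite !mulf_eq0 ![e t == 0]gt_eqF ?expR_gt0// !orbF => /eqP f10 /eqP f20.
by apply/eqP; rewrite eq_complex -/(f1 t) -/(f2 t) f10 f20 !eqxx.
Unshelve. all: by end_near. Qed.

End MellinUniqueness.

(** * The convolution *)

Section Bridge.
Context {R : realType}.
Local Notation mu := (@lebesgue_measure R).

Local Notation intble f := (mu.-integrable setT (EFin \o (f : R -> R))).

Lemma Rintegral_prod (f g : R -> R) : intble f -> intble g ->
  \int[(mu \x mu)%E]_z (f z.1 * g z.2) = (\int[mu]_x f x) * (\int[mu]_x g x).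
Proof.
move=> intf intg; rewrite -(Rintegral_fubini1 (integrable_prod intf intg)).
transitivity (\int[mu]_x (f x * \int[mu]_y g y)); last by rewrite RintegralZr.
by apply: eq_Rintegral => x _; rewrite /= RintegralZl.
Qed.

Lemma line_integralE (a : R) (H : R[i] -> R[i]) : line_integral a H =
  (- \int[mu]_t complex.Im (H (a +i* t))) +i* (\int[mu]_t complex.Re (H (a +i* t))).
Proof.
by apply/eqP; rewrite eq_complex/=; apply/andP; split; apply/eqP; rewrite /=; ring.
Qed.

(** From [pi >= 2] and [|s| >= |Im s|], the weight is at least [e^(2 |t|)]. *)
Lemma line_L1_exp_decay (a : R) (F : R[i] -> R[i]) :
  measurable_fun setT (fun t : R => complex.Re (F (a +i* t))) ->
  measurable_fun setT (fun t : R => complex.Im (F (a +i* t))) ->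
  line_Lp a 1 (fun s => (expR (pi * normc s))%:C * F s) ->
  exp_decay 2 (fun t : R => complex.Re (F (a +i* t))) /\
  exp_decay 2 (fun t : R => complex.Im (F (a +i* t))).
Proof.
move=> m1 m2 [[mh1 mh2] hL1].
pose w t : R := expR (pi * normc (a +i* t)).
pose h (t : R) : R[i] := (w t)%:C * F (a +i* t).
have mN : measurable_fun setT (fun t => normc (h t)).
  rewrite (_ : (fun t => _) =
      (fun t => Num.sqrt (complex.Re (h t) ^+ 2 + complex.Im (h t) ^+ 2))); last first.
    by apply/funext => t; case: (h t).
  apply: measurableT_comp_continuous; first exact: sqrt_continuous.
  by apply: measurable_funD; exact: measurable_funX.
have ih : intble (fun t => normc (h t)).
  apply/integrableP; split; first exact/measurable_EFinP.
  apply: le_lt_trans hL1; rewrite le_eqVlt; apply/orP; left; apply/eqP.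
  apply: eq_integral => t _; rewrite /= /cst mulr1 expr1 ger0_norm//.
  by case: (h t) => x y /=; rewrite sqrtr_ge0.
have wt t : expR (2 * `|t|) <= w t.
  rewrite ler_expR ler_pM//; first exact: pi_ge2.
  by rewrite /= -[leLHS]sqrtr_sqr ler_sqrt ?lerDr ?sqr_ge0// addr_ge0// sqr_ge0.
have hN t : normc (h t) = w t * normc (F (a +i* t)).
  rewrite /h Normc.normcM /=; congr (_ * _).
  by rewrite expr0n addr0 sqrtr_sqr ger0_norm// expR_ge0.
have dec (r : R -> R) : measurable_fun setT r ->
    (forall t, `|r t| <= normc (F (a +i* t))) -> exp_decay 2 r.
  move=> mr rF; split => //; apply: (integrable_le_norm _ ih) => [|t].
    apply: measurable_funM => //; apply: (measurableT_comp (@measurable_expR R)).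
    by apply: measurable_funM; [exact: measurable_cst|exact: (@normr_measurable R setT)].
  rewrite normrM mulrC hN normrM ler_pM//.
    by rewrite (ger0_norm (expR_ge0 _)) (le_trans (wt t))// ler_norm.
  by rewrite (le_trans (rF t))// ler_norm.
split; apply: dec => // t; case: (F _) => x y /=.
  by rewrite -[leLHS]sqrtr_sqr ler_sqrt ?lerDl ?sqr_ge0// addr_ge0// sqr_ge0.
by rewrite -[leLHS]sqrtr_sqr ler_sqrt ?lerDr ?sqr_ge0// addr_ge0// sqr_ge0.
Qed.

Let intbleB d (T : measurableType d) (nu : {measure set T -> \bar R}) (f1 f2 : T -> R) :
  nu.-integrable setT (EFin \o f1) -> nu.-integrable setT (EFin \o f2) ->
  nu.-integrable setT (EFin \o (fun x => f1 x - f2 x)).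
Proof.
by move=> i1 i2; have := integrableB measurableT i1 i2; apply: eq_integrable.
Qed.

Let intbleD d (T : measurableType d) (nu : {measure set T -> \bar R}) (f1 f2 : T -> R) :
  nu.-integrable setT (EFin \o f1) -> nu.-integrable setT (EFin \o f2) ->
  nu.-integrable setT (EFin \o (fun x => f1 x + f2 x)).
Proof.
by move=> i1 i2; have := integrableD measurableT i1 i2; apply: eq_integrable.
Qed.

(** The real part of [(P + i Q) r m (C - i S) = (P + i Q) (C - i S)] for complex numbers [r] and [m]
    with [r m = 1]; [unweight_im] is the imaginary part. *)
Let unweight_re (P Q ra rb ma mb C S : R) : ra * ma - rb * mb = 1 -> ra * mb + rb * ma = 0 ->
  (P * ra - Q * rb) * (ma * C + mb * S) - (P * rb + Q * ra) * (mb * C - ma * S) =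
  P * C + Q * S.
Proof.
move=> e1 e2; transitivity (P * ((ra * ma - rb * mb) * C + (ra * mb + rb * ma) * S) +
  Q * ((ra * ma - rb * mb) * S - (ra * mb + rb * ma) * C)); first by ring.
by rewrite e1 e2; ring.
Qed.

Let unweight_im (P Q ra rb ma mb C S : R) : ra * ma - rb * mb = 1 -> ra * mb + rb * ma = 0 ->
  (P * ra - Q * rb) * (mb * C - ma * S) + (P * rb + Q * ra) * (ma * C + mb * S) =
  Q * C - P * S.
Proof.
move=> e1 e2; transitivity (P * ((ra * mb + rb * ma) * C - (ra * ma - rb * mb) * S) +
  Q * ((ra * ma - rb * mb) * C + (ra * mb + rb * ma) * S)); first by ring.
by rewrite e1 e2; ring.
Qed.

Local Notation Fre f1 f2 := (fourier_re mu f1 f2 id).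
Local Notation Fim f1 f2 := (fourier_im mu f1 f2 id).

(** Here [r1 + i r2] is the weight [1 / m], and [m1 + i m2] its inverse [m]. Pairs are ordered as
    [(w, s)] because the outer integral is over [w]; [C] stands for the nonzero factor that depends
    on [y] alone. *)
Lemma weighted_convolution_null (f1 f2 g1 g2 r1 r2 m1 m2 C : R -> R) (M : R) :
  intble f1 -> intble f2 -> intble g1 -> intble g2 ->
  measurable_fun setT r1 -> measurable_fun setT r2 ->
  measurable_fun setT m1 -> measurable_fun setT m2 ->
  (forall t, [/\ `|r1 t| <= M, `|r2 t| <= M, `|m1 t| <= M & `|m2 t| <= M]) ->
  (forall t, C t != 0) ->
  (forall t, r1 t * m1 t - r2 t * m2 t = 1) ->
  (forall t, r1 t * m2 t + r2 t * m1 t = 0) ->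
  let p (z : R * R) := z.1 + z.2 in
  let P (z : R * R) := f1 z.2 * g1 z.1 - f2 z.2 * g2 z.1 in
  let Q (z : R * R) := f1 z.2 * g2 z.1 + f2 z.2 * g1 z.1 in
  let k1 z := P z * r1 (p z) - Q z * r2 (p z) in
  let k2 z := P z * r2 (p z) + Q z * r1 (p z) in
  (forall y, \int[mu]_w \int[mu]_s
      (C y * (k1 (w, s) * cos (y * (w + s)) + k2 (w, s) * sin (y * (w + s)))) = 0 /\
    \int[mu]_w \int[mu]_s
      (C y * (k2 (w, s) * cos (y * (w + s)) - k1 (w, s) * sin (y * (w + s)))) = 0) ->
  forall y, Fre f1 f2 y * Fre g1 g2 y - Fim f1 f2 y * Fim g1 g2 y = 0 /\
            Fre f1 f2 y * Fim g1 g2 y + Fim f1 f2 y * Fre g1 g2 y = 0.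
Proof.
move=> if1 if2 ig1 ig2 mr1 mr2 mm1 mm2 bM C0 rm1 rm2 p P Q k1 k2 k0 y.
have mp : measurable_fun setT p.
  by apply: measurable_funD; [exact: measurable_fst|exact: measurable_snd].
have iprod (f g : R -> R) : intble f -> intble g ->
    (mu \x mu)%E.-integrable setT (EFin \o (fun z => f z.2 * g z.1)).
  by move=> i_f i_g; under eq_fun do rewrite mulrC; exact: integrable_prod.
have iP : (mu \x mu)%E.-integrable setT (EFin \o P) by apply: intbleB; exact: iprod.
have iQ : (mu \x mu)%E.-integrable setT (EFin \o Q) by apply: intbleD; exact: iprod.
have bp (n : R -> R) (h : R * R -> R) (B : R) : (mu \x mu)%E.-integrable setT (EFin \o h) ->
    measurable_fun setT n -> (forall t, `|n t| <= B) ->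
    (mu \x mu)%E.-integrable setT (EFin \o (fun z => h z * n (p z))).
  move=> ih mn nB; apply: (integrable_mul_bounded (M := B) ih) => [|z]; last exact: nB.
  exact: (measurableT_comp mn mp).
have b1 t : `|r1 t| <= M by case: (bM t).
have b2 t : `|r2 t| <= M by case: (bM t).
have b3 t : `|m1 t| <= M by case: (bM t).
have b4 t : `|m2 t| <= M by case: (bM t).
have ik1 : (mu \x mu)%E.-integrable setT (EFin \o k1) by apply: intbleB; apply: bp; eauto.
have ik2 : (mu \x mu)%E.-integrable setT (EFin \o k2) by apply: intbleD; apply: bp; eauto.
(* By Fubini, each iterated integral at frequency [v] is [C v] times a double integral, namely the
   real or the imaginary part of the transform of [k1 + i k2] along [p]. *)
have [] := fourier_null_pair ik1 ik2 mp.
  move=> v; have [h1 h2] := k0 v; split.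
    have iK := intbleD (integrable_mul_cos v ik1 mp) (integrable_mul_sin v ik2 mp).
    move: h1; rewrite [LHS](Rintegral_fubini1 (integrableZl measurableT (C v) iK)).
    by rewrite RintegralZl// => /eqP; rewrite mulf_eq0 (negbTE (C0 v)) => /eqP.
  have iK := intbleB (integrable_mul_cos v ik2 mp) (integrable_mul_sin v ik1 mp).
  move: h2; rewrite [LHS](Rintegral_fubini1 (integrableZl measurableT (C v) iK)).
  rewrite RintegralZl// => /eqP; rewrite mulf_eq0 (negbTE (C0 v)) => /eqP <-.
  by apply: eq_Rintegral => z _; rewrite mulNr.
move=> n1 n2.
have mcos : measurable_fun setT (fun s : R => cos (y * s)).
  apply: measurableT_comp_continuous; first exact: continuous_cos.
  by apply: measurable_funM => //; exact: measurable_cst.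
have msin : measurable_fun setT (fun s : R => sin (y * s)).
  apply: measurableT_comp_continuous; first exact: continuous_sin.
  by apply: measurable_funM => //; exact: measurable_cst.
(* [q1 + i q2] is the bounded function [m(s) e^(-i y s)]: composed with [p], it undoes the weight
   and restores a kernel that factors over [w] and [s]. *)
pose q1 s := m1 s * cos (y * s) + m2 s * sin (y * s).
pose q2 s := m2 s * cos (y * s) - m1 s * sin (y * s).
have mq1 : measurable_fun setT q1 by apply: measurable_funD; exact: measurable_funM.
have mq2 : measurable_fun setT q2 by apply: measurable_funB; exact: measurable_funM.
have mle (u v : R) : `|u| <= M -> `|v| <= 1 -> `|u * v| <= M.
  move=> uM v1; rewrite normrM; apply: le_trans uM; rewrite ler_piMr//.
have bq1 s : `|q1 s| <= M + M.
  by rewrite (le_trans (ler_normD _ _))// lerD// mle// ?cos_max ?sin_max.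
have bq2 s : `|q2 s| <= M + M.
  by rewrite (le_trans (ler_normB _ _))// lerD// mle// ?cos_max ?sin_max.
have i11 := bp _ _ _ ik1 mq1 bq1; have i12 := bp _ _ _ ik1 mq2 bq2.
have i21 := bp _ _ _ ik2 mq1 bq1; have i22 := bp _ _ _ ik2 mq2 bq2.
have z11 := fourier_null_comp ik1 mp n1 mq1 i11.
have z12 := fourier_null_comp ik1 mp n1 mq2 i12.
have z21 := fourier_null_comp ik2 mp n2 mq1 i21.
have z22 := fourier_null_comp ik2 mp n2 mq2 i22.
pose A (u1 u2 : R -> R) (s : R) := u1 s * cos (y * s) + u2 s * sin (y * s).
have iA u1 u2 : intble u1 -> intble u2 -> intble (A u1 u2).
  move=> i1 i2; have mid := @measurable_id _ _ [set: R].
  exact: intbleD (integrable_mul_cos y i1 mid) (integrable_mul_sin y i2 mid).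
have iNf1 := integrableN_EFin if1; have iNg1 := integrableN_EFin ig1.
have iAg := iA _ _ ig1 ig2; have iBg := iA _ _ ig2 iNg1.
have iAf := iA _ _ if1 if2; have iBf := iA _ _ if2 iNf1.
have FE u1 u2 : \int[mu]_s A u1 u2 s = Fre u1 u2 y by [].
split.
- transitivity (\int[(mu \x mu)%E]_z (k1 z * q1 (p z) - k2 z * q2 (p z))); last first.
    by rewrite (RintegralB measurableT i11 i22) z11 z22 subrr.
  transitivity (\int[(mu \x mu)%E]_z (A g1 g2 z.1 * A f1 f2 z.2 -
      A g2 (\- g1) z.1 * A f2 (\- f1) z.2)).
    rewrite (RintegralB measurableT (integrable_prod iAg iAf) (integrable_prod iBg iBf)).
    by rewrite !Rintegral_prod// !FE /fourier_im; ring.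
  apply: eq_Rintegral => -[w s] _; rewrite /A /k1 /k2 /q1 /q2 /p /=.
  by rewrite unweight_re// /P /Q/= (mulrDr y) cosD sinD; ring.
- transitivity (\int[(mu \x mu)%E]_z (k1 z * q2 (p z) + k2 z * q1 (p z))); last first.
    by rewrite (RintegralD measurableT i12 i21) z12 z21 addr0.
  transitivity (\int[(mu \x mu)%E]_z (A g2 (\- g1) z.1 * A f1 f2 z.2 +
      A g1 g2 z.1 * A f2 (\- f1) z.2)).
    rewrite (RintegralD measurableT (integrable_prod iBg iAf) (integrable_prod iAg iBf)).
    by rewrite !Rintegral_prod// !FE /fourier_im; ring.
  apply: eq_Rintegral => -[w s] _; rewrite /A /k1 /k2 /q1 /q2 /p /=.
  by rewrite unweight_im// /P /Q/= (mulrDr y) cosD sinD; ring.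
Qed.

End Bridge.

(** * The cotangent factor on the line of integration, and the theorem *)

Section CotangentLine.
Context {R : realType}.
Local Notation mu := (@lebesgue_measure R).

Lemma pi_line (a t : R) : (pi : R)%:C * (a +i* t) = (pi * a) +i* (pi * t).
Proof. by apply/eqP; rewrite eq_complex/= !mul0r subr0 addr0 !eqxx. Qed.

(** Passing from [F] to [cot * F] loses nothing: boundedness of the cotangent keeps the decay, and
    its having no zero on the line lets almost-everywhere vanishing return to [F], hence to [f]. *)
Lemma line_cot_decay (a : R) (f : R -> R[i]) (F : R[i] -> R[i]) :
  0 < sin (pi * a) -> 0 < cos (pi * a) -> mellin_L2 a f -> is_mellin a f F ->
  line_Lp a 1 (fun s => (expR (pi * normc s))%:C * F s) ->
  exists f1 f2 : R -> R, [/\ exp_decay 2 f1, exp_decay 2 f2,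
    forall t, ccot ((pi : R)%:C * (a +i* t)) * F (a +i* t) = f1 t +i* f2 t &
    {ae mu, forall t, f1 t = 0} /\ {ae mu, forall t, f2 t = 0} ->
    {ae mu, forall x : R, 0 < x -> f x = 0}].
Proof.
move=> s0 c0 fL2 fF FL1.
have [[[m1 m2] _] _] := fF; have [d1 d2] := line_L1_exp_decay m1 m2 FL1.
have [M bM] := cot_bounded s0 c0.
have mpi : measurable_fun setT (fun t : R => pi * t).
  by apply: measurable_funM => //; exact: measurable_cst.
pose c1 t := cot_re (pi * a) (pi * t); pose c2 t := cot_im (pi * a) (pi * t).
have mc1 : measurable_fun setT c1 := measurableT_comp (measurable_cot_re _) mpi.
have mc2 : measurable_fun setT c2 := measurableT_comp (measurable_cot_im _) mpi.
have b1 t : `|c1 t| <= M by have [] := bM (pi * t).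
have b2 t : `|c2 t| <= M by have [] := bM (pi * t).
pose F1 t := complex.Re (F (a +i* t)); pose F2 t := complex.Im (F (a +i* t)).
exists (fun t => F1 t * c1 t - F2 t * c2 t), (fun t => F1 t * c2 t + F2 t * c1 t).
have E t : ccot ((pi : R)%:C * (a +i* t)) * F (a +i* t) =
    (F1 t * c1 t - F2 t * c2 t) +i* (F1 t * c2 t + F2 t * c1 t).
  rewrite pi_line ccotE// /F1 /F2; case: (F _) => x y.
  by apply/eqP; rewrite eq_complex/=; apply/andP; split; apply/eqP; rewrite /c1 /c2; ring.
split => //.
- apply: exp_decayD; first exact: exp_decayM b1.
  by apply: exp_decayN; exact: exp_decayM b2.
- apply: exp_decayD; first exact: exp_decayM b2.
  exact: exp_decayM b1.
move=> [z1 z2]; apply: (mellin_unique fL2 fF).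
move: z1 z2; apply: filterS2; first exact: (ae_filter_ringOfSetsType mu).
move=> t h1 h2; apply/eqP; have := E t; rewrite h1 h2 => /eqP.
by rewrite (_ : 0 +i* 0 = 0)// mulf_eq0 pi_line (negbTE (ccot_neq0 _ s0 c0)).
Qed.

End CotangentLine.

Theorem theorem4 (R : realType) (alpha : R) (f g : R -> R[i])
    (fs gs : R[i] -> R[i])
    (alpha_gt0 : 0 < alpha) (alpha_lt : alpha < 4^-1)
    (f_L2 : mellin_L2 alpha f) (g_L2 : mellin_L2 alpha g)
    (fsE : is_mellin alpha f fs) (gsE : is_mellin alpha g gs)
    (fs_L1 : line_Lp alpha 1 (fun s => (expR (pi * normc s))%:C * fs s))
    (gs_L1 : line_Lp alpha 1 (fun s => (expR (pi * normc s))%:C * gs s))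
    (conv0 : forall x : R, 0 < x -> mellin_cot_conv alpha fs gs x = 0) :
  {ae @lebesgue_measure R, forall x : R, 0 < x -> f x = 0} \/
  {ae @lebesgue_measure R, forall x : R, 0 < x -> g x = 0}.
Proof.
have pi0 := pi_gt0 R.
(* Used at [alpha] and at [2 alpha]; the latter is where [alpha < 1/4] is needed. *)
have sin_cos_gt0 (x : R) : 0 < x -> x < 2^-1 -> 0 < sin (pi * x) /\ 0 < cos (pi * x).
  move=> x0 x1; have xp : 0 < pi * x < pi / 2 by rewrite mulr_gt0// ltr_pM2l.
  split; first exact: sin_gt0_pihalf.
  by apply: cos_gt0_pihalf; move: xp; lra.
have [s1 c1] : 0 < sin (pi * alpha) /\ 0 < cos (pi * alpha) by apply: sin_cos_gt0; lra.
have [s2 c2] : 0 < sin (pi * (alpha + alpha)) /\ 0 < cos (pi * (alpha + alpha)).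
  by apply: sin_cos_gt0; lra.
have [f1 [f2 [df1 df2 fE fend]]] := line_cot_decay s1 c1 f_L2 fsE fs_L1.
have [g1 [g2 [dg1 dg2 gE gend]]] := line_cot_decay s1 c1 g_L2 gsE gs_L1.
have [M bM] := cot_bounded s2 c2.
pose X := pi * (alpha + alpha).
have mpi : measurable_fun setT (fun t : R => pi * t).
  by apply: measurable_funM => //; exact: measurable_cst.
have ei h : exp_decay 2 h -> lebesgue_measure.-integrable setT (EFin \o (h : R -> R)).
  exact: exp_decay_int.
have inv t : (tan_re X t +i* tan_im X t) * (cot_re X t +i* cot_im X t) = 1.
  by rewrite -ccotVE// -ccotE// mulVf// ccot_neq0.
suff prod0 : forall y,
    fourier_re lebesgue_measure f1 f2 id y * fourier_re lebesgue_measure g1 g2 id y -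
    fourier_im lebesgue_measure f1 f2 id y * fourier_im lebesgue_measure g1 g2 id y = 0 /\
    fourier_re lebesgue_measure f1 f2 id y * fourier_im lebesgue_measure g1 g2 id y +
    fourier_im lebesgue_measure f1 f2 id y * fourier_re lebesgue_measure g1 g2 id y = 0.
  have [f0|g0] := fourier_dichotomy df1 df2 dg1 dg2 prod0.
    by left; apply: fend; exact: fourier_pair_ae.
  by right; apply: gend; exact: fourier_pair_ae.
(* The weight is the tangent on the line [Re = 2 alpha], its inverse the cotangent. With [x = e^y],
   the modulus of [x^(-s-w)] is [e^(-2 alpha y)], which is the factor [C]. *)
apply: (@weighted_convolution_null _ _ _ _ _ (fun t => tan_re X (pi * t))
  (fun t => tan_im X (pi * t)) (fun t => cot_re X (pi * t))
  (fun t => cot_im X (pi * t))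
  (fun y => expR (- (2 * alpha * y))) M); do ?[exact: ei].
- exact: (measurableT_comp (measurable_tan_re X) mpi).
- exact: (measurableT_comp (measurable_tan_im X) mpi).
- exact: (measurableT_comp (measurable_cot_re X) mpi).
- exact: (measurableT_comp (measurable_cot_im X) mpi).
- by move=> t; have [? ? ? ?] := bM (pi * t); split.
- by move=> t; rewrite gt_eqF// expR_gt0.
- by move=> t; have /eqP := inv (pi * t); rewrite eq_complex => /andP[/eqP].
- by move=> t; have /eqP := inv (pi * t); rewrite eq_complex => /andP[_ /eqP].
move=> y.
set C := expR (- (2 * alpha * y)).
pose P w s := f1 s * g1 w - f2 s * g2 w; pose Q w s := f1 s * g2 w + f2 s * g1 w.
pose k1 w s := P w s * tan_re X (pi * (w + s)) - Q w s * tan_im X (pi * (w + s)).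
pose k2 w s := P w s * tan_im X (pi * (w + s)) + Q w s * tan_re X (pi * (w + s)).
pose H1 w s := k1 w s * cos (y * (w + s)) + k2 w s * sin (y * (w + s)).
pose H2 w s := k2 w s * cos (y * (w + s)) - k1 w s * sin (y * (w + s)).
have kE w s : ccot ((pi : R)%:C * (alpha +i* s)) * ccot ((pi : R)%:C * (alpha +i* w)) /
    ccot ((pi : R)%:C * ((alpha +i* s) + (alpha +i* w))) * fs (alpha +i* s) *
    gs (alpha +i* w) * cpow (expR y) (- (alpha +i* s) - (alpha +i* w)) =
    (C * H1 w s) +i* (C * H2 w s).
  have -> : (alpha +i* s) + (alpha +i* w) = (alpha + alpha) +i* (w + s).
    by apply/eqP; rewrite eq_complex/= addrC (addrC w) !eqxx.
  rewrite (pi_line (alpha + alpha)) ccotVE//.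
  rewrite /cpow expRK (_ : _ * y%:C = (- (2 * alpha * y)) +i* (- (y * (w + s)))); last first.
    by apply/eqP; rewrite eq_complex/=; apply/andP; split; apply/eqP; ring.
  rewrite cexpE cosN sinN -/C.
  transitivity ((ccot ((pi : R)%:C * (alpha +i* s)) * fs (alpha +i* s)) *
    (ccot ((pi : R)%:C * (alpha +i* w)) * gs (alpha +i* w)) *
    (tan_re X (pi * (w + s)) +i* tan_im X (pi * (w + s))) *
    ((C * cos (y * (w + s))) +i* (C * - sin (y * (w + s))))); first by ring.
  rewrite fE gE; apply/eqP; rewrite eq_complex/= /H1 /H2 /k1 /k2 /P /Q.
  by apply/andP; split; apply/eqP; ring.
have := conv0 (expR y) (expR_gt0 y); rewrite /mellin_cot_conv => /eqP.
have pi2i : 2 * (pi : R)%:C * 'i != 0 :> R[i].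
  rewrite !mulf_neq0 ?pnatr_eq0// eq_complex/= ?oner_eq0 ?andbF//.
  by rewrite negb_and (gt_eqF pi0).
pose inner (w : R[i]) := line_integral alpha (fun s => ccot ((pi : R)%:C * s) *
  ccot ((pi : R)%:C * w) / ccot ((pi : R)%:C * (s + w)) * fs s *
  gs w * cpow (expR y) (- s - w)).
have innerE w : inner (alpha +i* w) =
    (- \int[lebesgue_measure]_s (C * H2 w s)) +i* (\int[lebesgue_measure]_s (C * H1 w s)).
  by rewrite /inner line_integralE; congr (- _ +i* _); apply: eq_Rintegral => s _; rewrite kE.
rewrite mulf_eq0 invr_eq0 expf_eq0/= (negbTE pi2i) orFb => /eqP.
rewrite -/inner line_integralE => conv_y.
(* Each line integral contributes a factor [i] from [ds = i dt]; together they give -1, so both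
   parts of the double integral appear with a minus sign, here outside and in [h2] inside the inner
   integral. *)
have h1 : - (\int[lebesgue_measure]_w complex.Im (inner (alpha +i* w))) = 0.
  exact: (congr1 (fun z => complex.Re z) conv_y).
have h2 : (\int[lebesgue_measure]_w complex.Re (inner (alpha +i* w))) = 0.
  exact: (congr1 (fun z => complex.Im z) conv_y).
split.
- move/eqP: h1; rewrite oppr_eq0 => /eqP <-.
  by apply: eq_Rintegral => w _; rewrite innerE.
- rewrite -[RHS]oppr0 -h2 -RintegralN.
  by apply: eq_Rintegral => w _; rewrite innerE/= opprK.
Qed.
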